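(* Let $k$ be a field, let $R=k[x,y,z]$ with the standard grading, and let $R/I$ be a standard graded Artinian Gorenstein algebra of codimension three, with Hilbert function $\underline{h}=(1,3,h_2,\dots,h_{c-1},h_c)$, where $c$ is the largest degree with $h_c\neq 0$. Let $n_1,n_2,N_1,N_2$ be the integers determined by the third difference $\Delta^3\underline{h}$ of the Hilbert function as follows: $n_1=\min\{t \mid \Delta^3\underline{h}(t)<0\}$, $n_2=\min\{t>0\mid \Delta^3\underline{h}(t)>0\}$, $N_1=\max\{t\le c+1\mid \Delta^3\underline{h}(t)<0\}$, $N_2=\max\{t\mid \Delta^3\underline{h}(t)>0\}$. Then $$\frac{1}{3!}\,n_1\,n_2\,(c+3)\;\le\; e(R/I)\;\le\;\frac{1}{3!}\,N_1\,N_2\,(c+3).$$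
   Context: $I\subset R$ is a homogeneous ideal; the Hilbert function is $h_t=\dim_k (R/I)_t$, with the convention $h_t=0$ for $t<0$ and for $t>c$. That $R/I$ has codimension three with $h_1=3$ means that $I$ contains no nonzero linear form. The third difference is $\Delta^3\underline{h}(t)=h_t-3h_{t-1}+3h_{t-2}-h_{t-3}$. The number $e(R/I)$ is the multiplicity (degree) of $R/I$; since $R/I$ is Artinian, $e(R/I)=\dim_k(R/I)=\sum_{t=0}^{c}h_t$. *)

(* Defs.v *)
From HB Require Import structures.
From Stdlib Require Import ClassicalEpsilon.
From mathcomp Require Import all_boot all_order all_algebra.
From mathcomp Require Import ring_quotient.
From mathcomp Require Import mpoly.

Set Implicit Arguments.
Unset Strict Implicit.
Unset Printing Implicit Defensive.

Import Order.TTheory GRing.Theory Num.Theory.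

Local Open Scope ring_scope.
Local Open Scope quotient_scope.

(* Ideals are Prop-valued here (and may be the unit ideal), unlike [idealr]. *)
Definition is_ideal (A : comNzRingType) (J : A -> Prop) : Prop :=
  [/\ J 0,
      forall a b, J a -> J b -> J (a + b)
    & forall r a, J a -> J (r * a)].

Definition artinian (A : comNzRingType) : Prop :=
  forall J : nat -> A -> Prop,
    (forall i, is_ideal (J i)) ->
    (forall i a, J i.+1 a -> J i a) ->
    exists m, forall i, (m <= i)%N -> forall a, J m a -> J i a.

Section VectorSpaces.
Variables (k : fieldType) (V : lmodType k).

Definition has_basis (S : V -> Prop) (d : nat) (b : 'I_d -> V) : Prop :=
  [/\ forall i, S (b i),
      forall a : 'I_d -> k, \sum_(i < d) a i *: b i = 0 -> forall i, a i = 0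
    & forall v, S v -> exists a : 'I_d -> k, v = \sum_(i < d) a i *: b i].

(* The dimension of a finite-dimensional linear subspace S of V; the value is
   unspecified when S has no finite basis. *)
Definition kdim (S : V -> Prop) : nat :=
  epsilon (inhabits 0%N) (fun d => exists b : 'I_d -> V, has_basis S b).

End VectorSpaces.

(* The k-vector space structure of k[x_1, ..., x_n]/I, which the library only
   provides as a commutative ring. *)
Section QuotientLmodule.
Variables (k : fieldType) (n : nat) (I : idealr {mpoly k[n]}).
Local Notation Q := {ideal_quot I}.

Definition quot_scale (c : k) (a : Q) : Q := \pi_Q c%:MP * a.

Fact quot_scaleA c d a : quot_scale c (quot_scale d a) = quot_scale (c * d) a.
Proof. by rewrite /quot_scale mulrA -rmorphM /= -mpolyCM. Qed.

Fact quot_scale1 : left_id 1 quot_scale.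
Proof. by move=> a; rewrite /quot_scale mpolyC1 rmorph1 mul1r. Qed.

Fact quot_scaleDr : right_distributive quot_scale +%R.
Proof. by move=> c a b; rewrite /quot_scale mulrDr. Qed.

Fact quot_scaleDl a : {morph quot_scale^~ a : c d / c + d}.
Proof. by move=> c d; rewrite /quot_scale mpolyCD rmorphD mulrDl. Qed.

HB.instance Definition _ := GRing.Zmodule_isLmodule.Build k Q
  quot_scaleA quot_scale1 quot_scaleDr quot_scaleDl.

End QuotientLmodule.

Section GradedQuotient.
Variables (k : fieldType) (n : nat) (I : idealr {mpoly k[n]}).
Local Notation Q := {ideal_quot I}.

Definition homogeneous_ideal : Prop :=
  forall (d : nat) (p : {mpoly k[n]}), p \in I -> pihomog mdeg d p \in I.

Definition graded_piece (d : nat) (a : Q) : Prop :=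
  exists2 p : {mpoly k[n]}, p \is d.-homog & a = \pi_Q p.

Definition hilb (t : int) : nat :=
  match t with
  | Posz d => kdim (graded_piece d)
  | Negz _ => 0%N
  end.

(* The annihilator of the irrelevant maximal ideal. *)
Definition socle (a : Q) : Prop := forall i : 'I_n, \pi_Q 'X_i * a = 0.

(* For a graded Artinian algebra, being Gorenstein means having a
   one-dimensional socle. *)
Definition artinian_gorenstein : Prop :=
  artinian Q /\ exists s : 'I_1 -> Q, has_basis socle s.

(* The multiplicity of an Artinian algebra is its length. *)
Definition artinian_mult : nat := kdim (fun _ : Q => True).

End GradedQuotient.

Definition third_diff (h : int -> nat) (t : int) : int :=
  (h t)%:Z - 3 * (h (t - 1))%:Z + 3 * (h (t - 2))%:Z - (h (t - 3))%:Z.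

Definition is_min (P : int -> Prop) (m : int) : Prop :=
  P m /\ forall t, P t -> m <= t.

Definition is_max (P : int -> Prop) (m : int) : Prop :=
  P m /\ forall t, P t -> t <= m.

(* Main.v *)
(** Macaulay duality: the socle of A = R/I is A_c, a line, and the functional
    mu : R_c -> R_c / I_c = k determines I, so that h_t is the rank of the
    catalecticant matrix of the pairing (p, q) |-> mu (p q) on R_t x R_(c-t).
    These ranks are symmetric and do not change when k is enlarged to k(T).
    Over k(T) take l = x - T z.  The multiplication A_(t-1) -> A_t by l is dual
    to A_(c-t) -> A_(c+1-t), so with d_t = dim (A/lA)_t one gets
    h_t - h_(t-1) = d_t - d_(c+1-t).  As A/lA is a quotient of a polynomial ring
    in two variables, d is nonincreasing and at most the initial degree a of I
    from degree a on; hence 0 <= h_t - h_(t-1) <= a for a <= t <= (c+1)/2.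

    Put s = c + 3, g_t = h_t - h_(t-1), a = n1 and b = n2.  The third difference
    is antisymmetric under t |-> s - t, so N2 = s - a and N1 = s - b, and
    e = sum_(2j <= s-2) g_j (s - 2 - 2j), where g_j = j + 1 for j < a and g is
    concave up to b - 1.  The lower bound follows from comparing g with the chord
    from (a - 1, a) to (b - 1, 0) or to the centre ((s - 2)/2, 0); the upper bound
    from g <= a and, when b > s/2, from g being linear between s - b and the
    centre. *)

From HB Require Import structures.
From Stdlib Require Import ClassicalEpsilon.
Require Import Defs.
From mathcomp Require Import all_boot all_order all_algebra.
From mathcomp Require Import ring_quotient fraction.
From mathcomp Require Import mpoly.
From mathcomp Require Import zify ring lra.

Set Implicit Arguments.
Unset Strict Implicit.
Unset Printing Implicit Defensive.

Import Order.TTheory GRing.Theory Num.Theory.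
Local Open Scope ring_scope.
Local Open Scope quotient_scope.

(** * Catalecticant matrices *)

Definition tri (t : nat) : seq (nat * nat) :=
  [seq (i, j) | i <- iota 0 t.+1, j <- iota 0 (t.+1 - i)].

Lemma mem_tri t p : (p \in tri t) = (p.1 + p.2 <= t)%N.
Proof.
apply/allpairsPdep/idP => [[i [j [+ + ->]]]|].
  by rewrite !mem_iota; move=> /andP[_ hi] /andP[_ hj] /=; lia.
case: p => i j ij; exists i, j; rewrite !mem_iota !add0n !leq0n ltn_subRL !ltnS.
by split=> //; apply: leq_trans ij => /=; rewrite leq_addr.
Qed.

Lemma tri_uniq t : uniq (tri t).
Proof.
apply: allpairs_uniq_dep => [|i _|]; rewrite ?iota_uniq //.
by move=> [i j] [i' j'] _ _ /= [-> ->].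
Qed.

Lemma size_tri t : size (tri t) = 'C(t.+2, 2).
Proof.
rewrite size_allpairs_dep sumnE big_map (eq_bigr (fun i => t.+1 - i)%N); last first.
  by move=> i _; rewrite size_iota.
rewrite -{1}(subn0 t.+1) -/(index_iota 0 t.+1) big_nat_rev /= -bin2_sum.
rewrite [RHS]big_nat_recl // add0n; apply: eq_big_nat => i; lia.
Qed.

(* An element (i, j) stands for the monomial x^i y^j z^(t-i-j). *)
Definition mon (t : nat) : finType := seq_sub (tri t).

Lemma card_mon t : #|mon t| = 'C(t.+2, 2).
Proof. by rewrite card_seq_sub ?size_tri ?tri_uniq. Qed.

Lemma monP t (m : mon t) : ((val m).1 + (val m).2 <= t)%N.
Proof. by rewrite -mem_tri; exact: valP. Qed.

Fact mkmon_subproof t (i j : nat) : (i + j <= t)%N -> (i, j) \in tri t.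
Proof. by rewrite mem_tri. Qed.

Definition mkmon t i j (H : (i + j <= t)%N) : mon t := SeqSub (mkmon_subproof H).

Fact mul_mon_subproof t (v : mon 1) (m : mon t) :
  ((val v).1 + (val m).1 + ((val v).2 + (val m).2) <= t.+1)%N.
Proof. have := monP m; have := monP v; lia. Qed.

Definition mul_mon t (v : mon 1) (m : mon t) : mon t.+1 :=
  mkmon (mul_mon_subproof v m).

Definition mon_x : mon 1 := @mkmon 1 1 0 isT.
Definition mon_y : mon 1 := @mkmon 1 0 1 isT.
Definition mon_z : mon 1 := @mkmon 1 0 0 isT.

Section Catalecticant.
Variable K : fieldType.
Implicit Types (mu : nat -> nat -> K) (t u : nat).

(* The matrix of the pairing R_t x R_u -> K induced by the functional on
   R_(t+u) with value mu i j at x^i y^j z^(t+u-i-j). *)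
Definition cat mu t u : 'M[K]_(#|mon t|, #|mon u|) :=
  \matrix_(a, b) mu ((val (enum_val a)).1 + (val (enum_val b)).1)%N
                    ((val (enum_val a)).2 + (val (enum_val b)).2)%N.

Lemma cat_tr mu t u : (cat mu t u)^T = cat mu u t.
Proof.
apply/matrixP => a b; rewrite !mxE.
by rewrite !(addnC (val (enum_val b)).1, addnC (val (enum_val b)).2).
Qed.

Lemma rank_cat_sym mu t u : \rank (cat mu t u) = \rank (cat mu u t).
Proof. by rewrite -cat_tr mxrank_tr. Qed.

Definition mul_mx t (v : mon 1) : 'M[K]_(#|mon t|, #|mon t.+1|) :=
  \matrix_(a, b) (enum_val b == mul_mon v (enum_val a))%:R.

Lemma mul_mxE t v n (M : 'M[K]_(_, n)) a j :
  (mul_mx t v *m M) a j = M (enum_rank (mul_mon v (enum_val a))) j.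
Proof.
rewrite mxE (bigD1 (enum_rank (mul_mon v (enum_val a)))) //= big1 ?addr0.
  by rewrite mxE enum_rankK eqxx mul1r.
move=> b; rewrite mxE => nb; case: eqP => [eb|_]; last by rewrite mul0r.
by rewrite -eb enum_valK eqxx in nb.
Qed.

(** Multiplication by a variable is self-adjoint for the pairing: both sides compute mu (v p q). *)
Lemma mul_cat mu t u v :
  mul_mx t v *m cat mu t.+1 u = cat mu t u.+1 *m (mul_mx u v)^T.
Proof.
apply/matrixP => a b; rewrite -[cat mu t u.+1]cat_tr -trmx_mul mul_mxE [RHS]mxE mul_mxE.
by rewrite !mxE !enum_rankK /=; congr mu; rewrite [RHS]addnC addnCA addnA.
Qed.

(** * Multiplication by, and restriction modulo, the linear form x - T z *)

Variable T : K.

(* The functional p |-> mu ((x - T z) p). *)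
Definition lin_fun mu i j : K := mu i.+1 j - T * mu i j.

Definition lin_mx t := mul_mx t mon_x - T *: mul_mx t mon_z.

Lemma lin_cat mu t u : lin_mx t *m cat mu t.+1 u = cat (lin_fun mu) t u.
Proof.
apply/matrixP => a b; rewrite mulmxBl -scalemxAl mxE mul_mxE mxE [X in _ + X]mxE.
by rewrite [X in - X]mxE mul_mxE !mxE !enum_rankK.
Qed.

(* The restriction of the quotient map R -> R / (x - T z), dehomogenized by
   z = 1. *)
Definition res_mx t : 'M[K]_(#|mon t|, t.+1) :=
  \matrix_(a < #|mon t|, j < t.+1)
    (T ^+ (val (enum_val a)).1 *+ ((val (enum_val a)).2 == j :> nat)).

(** A section of [res_mx]: y^j is lifted to the monomial y^j z^(t-j). *)
Definition sec_mx t : 'M[K]_(t.+1, #|mon t|) :=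
  \matrix_(j < t.+1, a < #|mon t|) (val (enum_val a) == (0%N, nat_of_ord j))%:R.

Lemma sec_mxE t n (M : 'M[K]_(_, n)) j k :
  (sec_mx t *m M) j k = M (enum_rank (@mkmon t 0 j (ltn_ord j))) k.
Proof.
rewrite mxE (bigD1 (enum_rank (@mkmon t 0 j (ltn_ord j)))) //= big1 ?addr0.
  by rewrite mxE enum_rankK eqxx mul1r.
move=> b; rewrite mxE => nb; case: eqP => [eb|_]; last by rewrite mul0r.
by case/negP: nb; apply/eqP/enum_val_inj; rewrite enum_rankK; apply/val_inj.
Qed.

Lemma sec_res t : sec_mx t *m res_mx t = 1%:M.
Proof.
by apply/matrixP => i j; rewrite sec_mxE !mxE enum_rankK /= expr0.
Qed.

Lemma rank_res t : \rank (res_mx t) = t.+1.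
Proof. by apply/eqP/row_fullP; exists (sec_mx t); rewrite sec_res. Qed.

Lemma lin_res t : lin_mx t *m res_mx t.+1 = 0.
Proof.
apply/matrixP => a b; rewrite mulmxBl -scalemxAl !mxE.
have := mul_mxE mon_x (res_mx t.+1) a b; rewrite mxE => ->.
have := mul_mxE mon_z (res_mx t.+1) a b; rewrite mxE => ->.
by rewrite !mxE !enum_rankK /= !add0n add1n exprS mulrnAr subrr.
Qed.

(* Modulo x - T z, every monomial x^i y^j z^* is T^i y^j z^*. *)
Lemma lin_res_sec t (m : mon t.+1) :
  (row (enum_rank m) (1%:M - res_mx t.+1 *m sec_mx t.+1) <= lin_mx t)%MS.
Proof.
case: m => -[i j] Hm; have ij := Hm; rewrite mem_tri /= in ij.
have -> : SeqSub Hm = mkmon ij by apply/val_inj.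
have rowE i' (H : (i' + j <= t.+1)%N) :
  row (enum_rank (mkmon H)) (1%:M - res_mx t.+1 *m sec_mx t.+1) =
  delta_mx 0 (enum_rank (mkmon H))
   - T ^+ i' *: delta_mx 0 (enum_rank (@mkmon t.+1 0 j (leq_trans (leq_addl _ _) H))).
  have jt : (j < t.+2)%N by lia.
  apply/rowP => b; rewrite !mxE eqxx /= eq_sym; congr (_ - _).
  rewrite (bigD1 (Ordinal jt)) //= big1 ?addr0 => [|k nk]; last first.
    rewrite !mxE enum_rankK /=; case: eqP => [jk|]; last by rewrite mulr0n mul0r.
    by case/negP: nk; apply/eqP/val_inj.
  rewrite !mxE enum_rankK /= eqxx mulr1n; congr (_ * _%:R).
  by congr nat_of_bool; rewrite -[b in RHS]enum_valK (inj_eq enum_rank_inj) -val_eqE.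
rewrite rowE; move: (leq_trans _ _) => jt.
elim: i ij {Hm} => [|i IH] ij.
  rewrite expr0 scale1r (_ : mkmon ij = @mkmon t.+1 0 j jt) ?subrr ?sub0mx //.
  exact/val_inj.
have ij' : (i + j <= t.+1)%N by lia.
have ij2 : (i + j <= t)%N by lia.
set e0 := delta_mx 0 (enum_rank (@mkmon t.+1 0 j jt)) in IH *.
set e1 := delta_mx 0 (enum_rank (mkmon ij)).
set e2 := delta_mx 0 (enum_rank (mkmon ij')) : 'rV[K]_(#|mon t.+1|).
have -> : e1 - T ^+ i.+1 *: e0 = (e1 - T *: e2) + T *: (e2 - T ^+ i *: e0).
  by rewrite exprS -scalerA scalerBr addrA subrK.
rewrite addmx_sub ?scalemx_sub ?IH //.
rewrite (_ : _ - _ = row (enum_rank (mkmon ij2)) (lin_mx t)) ?row_sub //.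
apply/rowP => b; rewrite !mxE !enum_rankK eqxx /=.
rewrite -{1 2}[b]enum_valK !(inj_eq enum_rank_inj).
by congr (_%:R - _ * _%:R).
Qed.

(** Exactness of R_t -> R_(t+1) -> (R/(x - T z))_(t+1): the projector [D] fixes the kernel of
    restriction, and its rows are multiples of x - T z by [lin_res_sec]. *)
Lemma lin_mx_ker t : (lin_mx t :=: kermx (res_mx t.+1))%MS.
Proof.
apply/eqmxP; rewrite sub_kermx lin_res eqxx /=.
set D := 1%:M - res_mx t.+1 *m sec_mx t.+1.
have -> : kermx (res_mx t.+1) = kermx (res_mx t.+1) *m D.
  by rewrite mulmxBr mulmx1 mulmxA mulmx_ker mul0mx subr0.
apply: submx_trans (submxMl _ _) _.
by apply/row_subP => a; rewrite -[a]enum_valK lin_res_sec.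
Qed.

(** The image of I_t in R/(x - T z), where I_t is the left kernel of the catalecticant: one degree
    of a homogeneous ideal in two variables. *)
Definition res_ker mu t u := kermx (cat mu t u) *m res_mx t.

(* With A = R/I, the rank of cat mu t u is dim A_t and that of
   cat (lin_fun mu) t u is the rank of A_t -> A_(t+1); their difference is the
   dimension of (A/(x - T z)A)_(t+1), a quotient of a polynomial ring in two
   variables. *)
Lemma rank_cat_lin mu t u :
  (\rank (cat mu t.+1 u) + \rank (res_ker mu t.+1 u) =
   \rank (cat (lin_fun mu) t u) + t.+2)%N.
Proof.
(* Rank-nullity for I_(t+1) under restriction and for the multiples of x - T z under [cat]: by
   [lin_mx_ker] both kernels are the same intersection. *)
have := mxrank_mul_ker (kermx (cat mu t.+1 u)) (res_mx t.+1).
have := mxrank_mul_ker (lin_mx t) (cat mu t.+1 u).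
rewrite lin_cat mxrank_ker (cap_eqmx (lin_mx_ker t) (eqmx_refl _)) lin_mx_ker.
rewrite mxrank_ker rank_res capmxC -/(res_ker _ _ _).
have := rank_leq_row (res_mx t.+1); rewrite rank_res.
have := rank_leq_row (cat mu t.+1 u); lia.
Qed.

(** * Growth of a homogeneous ideal in two variables *)

Definition pad_mx n : 'M[K]_(n, n.+1) := \matrix_(i, j) (j == i :> nat)%:R.
(** On coefficient vectors of polynomials in y of degree < n, [shift_mx] multiplies by y, and
    [pad_mx] raises the degree bound, which is multiplication by z before z = 1. *)
Definition shift_mx n : 'M[K]_(n, n.+1) := \matrix_(i, j) (j == i.+1 :> nat)%:R.

Lemma mul_padE n (v : 'rV[K]_n) i (Hi : (i < n)%N) (Hi' : (i < n.+1)%N) :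
  (v *m pad_mx n) 0 (Ordinal Hi') = v 0 (Ordinal Hi).
Proof.
rewrite mxE (bigD1 (Ordinal Hi)) //= big1 ?addr0; first by rewrite mxE eqxx mulr1.
move=> k nk; rewrite mxE /=; case: eqP => [e|]; last by rewrite mulr0.
by case/negP: nk; apply/eqP/val_inj.
Qed.

Lemma mul_pad_max n (v : 'rV[K]_n) : (v *m pad_mx n) 0 ord_max = 0.
Proof.
rewrite mxE big1 // => k _; rewrite mxE /= (gtn_eqF (ltn_ord k)) mulr0 //.
Qed.

Lemma mul_shiftE n (v : 'rV[K]_n) i (Hi : (i < n)%N) (Hi' : (i.+1 < n.+1)%N) :
  (v *m shift_mx n) 0 (Ordinal Hi') = v 0 (Ordinal Hi).
Proof.
rewrite mxE (bigD1 (Ordinal Hi)) //= big1 ?addr0; first by rewrite mxE eqxx mulr1.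
move=> k nk; rewrite mxE /= eqSS; case: eqP => [e|]; last by rewrite mulr0.
by case/negP: nk; apply/eqP/val_inj.
Qed.

Lemma pad_free n : row_free (pad_mx n).
Proof.
apply/row_freeP; exists (pad_mx n)^T; apply/matrixP => i j.
rewrite mxE (bigD1 (widen_ord (leqnSn n) i)) //= big1 ?addr0.
  by rewrite !mxE /= eqxx mul1r.
move=> k nk; rewrite !mxE; case: eqP => [e|]; last by rewrite mul0r.
by case/negP: nk; apply/eqP/val_inj.
Qed.

(* A nonzero space of polynomials of degree < n is not stable under
   multiplication by the variable: look at an element of top degree. *)
Lemma rank_pad_shift m n (J : 'M[K]_(m, n)) m' (J' : 'M[K]_(m', n.+1)) :
    (J *m pad_mx n <= J')%MS -> (J *m shift_mx n <= J')%MS -> J != 0 ->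
  (\rank J < \rank J')%N.
Proof.
move=> Jp Js; apply: contraNT; rewrite -leqNgt => rJ.
have eqJ : (J' <= J *m pad_mx n)%MS.
  have := mxrank_leqif_sup Jp; rewrite mxrankMfree ?pad_free // => -[rJ' <-].
  by rewrite eqn_leq rJ' rJ.
have {}Js := submx_trans Js eqJ.
suff H i (v : 'rV_n) (Hi : (i < n)%N) : (v <= J)%MS -> v 0 (Ordinal Hi) = 0.
  by apply/eqP/row_matrixP => r; apply/rowP => -[i Hi]; rewrite H ?row_sub // row0 mxE.
(* Descending induction on the index: y v equals a padded element of J, so coefficient i of v is
   coefficient i + 1 of that element, and the padded coefficient n is 0. *)
have [k Hk] := ubnP (n - i)%N; elim: k => // k IH in i v Hi Hk * => vJ.
have /submxP[w Ew] : (v *m shift_mx n <= J *m pad_mx n)%MS.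
  by apply: submx_trans (submxMr _ vJ) Js.
have Hi' : (i.+1 < n.+1)%N by [].
rewrite -(mul_shiftE v Hi Hi') Ew mulmxA.
have [Hin|Hin] := ltnP i.+1 n; last first.
  have -> : Ordinal Hi' = ord_max by apply/val_inj => /=; lia.
  exact: mul_pad_max.
by rewrite (mul_padE _ Hin) IH ?submxMl //; lia.
Qed.

Lemma mul_res_z t : mul_mx t mon_z *m res_mx t.+1 = res_mx t *m pad_mx t.+1.
Proof.
apply/matrixP => a j; rewrite mul_mxE !mxE enum_rankK /= !add0n.
have am := monP (enum_val a).
have Ha : ((val (enum_val a)).2 < t.+1)%N by lia.
rewrite (bigD1 (Ordinal Ha)) //= big1 ?addr0 => [|k nk].
  by rewrite !mxE eqxx mulr1n mulr_natr eq_sym.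
rewrite !mxE; case: eqP => [e|]; last by rewrite mulr0n mul0r.
by case/negP: nk; apply/eqP/val_inj.
Qed.

Lemma mul_res_y t : mul_mx t mon_y *m res_mx t.+1 = res_mx t *m shift_mx t.+1.
Proof.
apply/matrixP => a j; rewrite mul_mxE !mxE enum_rankK /= !add0n add1n.
have am := monP (enum_val a).
have Ha : ((val (enum_val a)).2 < t.+1)%N by lia.
rewrite (bigD1 (Ordinal Ha)) //= big1 ?addr0 => [|k nk].
  by rewrite !mxE eqxx mulr1n mulr_natr eq_sym.
rewrite !mxE; case: eqP => [e|]; last by rewrite mulr0n mul0r.
by case/negP: nk; apply/eqP/val_inj.
Qed.

Lemma ker_mul mu t u v :
  (kermx (cat mu t u.+1) *m mul_mx t v <= kermx (cat mu t.+1 u))%MS.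
Proof. by rewrite sub_kermx -mulmxA mul_cat mulmxA mulmx_ker mul0mx. Qed.

Lemma rank_res_ker mu t u : res_ker mu t u.+1 != 0 ->
  (\rank (res_ker mu t u.+1) < \rank (res_ker mu t.+1 u))%N.
Proof.
apply: rank_pad_shift; rewrite /res_ker -mulmxA -?mul_res_z -?mul_res_y mulmxA;
  exact/submxMr/ker_mul.
Qed.

(** The polynomial ring in two variables gains exactly one dimension per degree, so this makes dim
    (A/(x - T z)A) nonincreasing once the ideal is nonzero. *)
Lemma rank_res_ker_ge mu a n u : res_ker mu a (n + u) != 0 ->
  (\rank (res_ker mu a (n + u)) + n <= \rank (res_ker mu (n + a) u))%N.
Proof.
elim: n => [|n IH] in u * => nz; first by rewrite addn0.
move: IH => /(_ u.+1); rewrite addnS -addSn => /(_ nz) IH.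
rewrite addnS (leq_ltn_trans IH) // rank_res_ker // -mxrank_eq0 -lt0n.
by rewrite (leq_trans _ IH) // ltn_addr // lt0n mxrank_eq0.
Qed.

(* With d_s = dim (A/(x - T z)A)_s, self-duality of multiplication by x - T z
   gives h_t - h_(t-1) = d_t - d_(c+1-t), where d is nonincreasing and at most
   a from degree a on. *)
Lemma rank_cat_diff mu a c t : res_ker mu a (c - a) != 0 ->
  (0 < a <= t)%N -> (t + t <= c.+1)%N -> (t <= c)%N ->
  (\rank (cat mu t.-1 (c - t.-1)) <= \rank (cat mu t (c - t)) <=
   \rank (cat mu t.-1 (c - t.-1)) + a)%N.
Proof.
case: t => [|t]; first by lia.
move=> nz /= ht1 ht2 ht3.
pose u := (c - t.+1)%N; have eu : (c - t = u.+1)%N by rewrite /u; lia.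
rewrite -/u eu.
(* With rho the rank of x - T z on degree t, [E1] says h_(t+1) - rho = d_(t+1), and [E2],
   transposed, says h_t - rho = d_(u+1). Below, [R1] gives d_(t+1) <= a and [R2] gives d_(u+1) <=
   d_(t+1). *)
have E1 := rank_cat_lin mu t u.
have E2 := rank_cat_lin mu u t.
rewrite (rank_cat_sym _ u t) (rank_cat_sym _ u.+1 t) in E2.
have nzr : (0 < \rank (res_ker mu a (c - a)))%N by rewrite lt0n mxrank_eq0.
have R1 : (t.+1 - a < \rank (res_ker mu t.+1 u))%N.
  have := @rank_res_ker_ge mu a (t.+1 - a) u.
  rewrite (_ : t.+1 - a + u = c - a)%N; last by rewrite /u; lia.
  rewrite subnK; last by lia.
  by move/(_ nz); apply: leq_trans; lia.
have R2 : (\rank (res_ker mu t.+1 u) + (u - t) <= \rank (res_ker mu u.+1 t))%N.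
  have := @rank_res_ker_ge mu t.+1 (u - t) t.
  rewrite subnK; last by rewrite /u; lia.
  rewrite (_ : u - t + t.+1 = u.+1)%N; last by rewrite /u; lia.
  by apply; rewrite -mxrank_eq0 -lt0n; lia.
have R3 := rank_leq_col (res_ker mu u.+1 t).
have R4 : (\rank (cat (lin_fun mu) t u) <= \rank (cat mu t u.+1))%N.
  rewrite -(rank_cat_sym _ u t) -(rank_cat_sym _ u.+1 t) -lin_cat; exact: mxrankM_maxr.
have le_tu : (t <= u)%N by rewrite /u; lia.
move: (\rank (cat mu t.+1 u)) (\rank (cat mu t u.+1)) (\rank (cat _ t u)) (\rank _)
  E1 E2 R1 R2 R4 {nzr} => h h' rho j E1 E2 R1 R2 R4.
by apply/andP; split; lia.
Qed.

End Catalecticant.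

(** * Extension of scalars from k to k(T) *)

Definition tofrac_map (k : fieldType) : k -> {fraction {poly k}} :=
  @tofrac {poly k} \o polyC.

HB.instance Definition _ (k : fieldType) :=
  GRing.RMorphism.copy (@tofrac_map k) (@tofrac {poly k} \o polyC).

(* Over k(T) the linear form x - T z divides no nonzero polynomial with
   coefficients in k. *)
Lemma res_ker_neq0 (k : fieldType) (mu : nat -> nat -> k) t u :
  (\rank (cat mu t u) < 'C(t.+2, 2))%N ->
  res_ker (tofrac 'X) (fun i j => tofrac_map (mu i j)) t u != 0.
Proof.
rewrite -card_mon => hr; rewrite /res_ker.
have -> : cat (fun i j => tofrac_map (mu i j)) t u = map_mx (@tofrac_map k) (cat mu t u).
  by apply/matrixP => a b; rewrite !mxE.
rewrite -map_kermx.
have : kermx (cat mu t u) != 0.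
  by rewrite -mxrank_eq0 mxrank_ker subn_eq0 -ltnNge.
apply: contraNneq => /matrixP E; apply/eqP/matrixP => r a; rewrite [RHS]mxE.
have am := monP (enum_val a).
have Ha : ((val (enum_val a)).2 < t.+1)%N by lia.
have {E} := E r (Ordinal Ha); rewrite mxE [RHS]mxE.
set v := kermx _ in am *.
(* The restricted entry is this polynomial evaluated at the transcendental T, so its vanishing kills
   each coefficient separately. *)
pose p := \sum_(b < #|mon t| | (val (enum_val b)).2 == (val (enum_val a)).2)
            v r b *: 'X^((val (enum_val b)).1) : {poly k}.
have -> : \sum_j map_mx (@tofrac_map k) v r j * res_mx (tofrac 'X) t j (Ordinal Ha) = tofrac p.
  rewrite /p rmorph_sum /= [RHS]big_mkcond; apply: eq_bigr => b _.
  rewrite !mxE /=; case: eqP => _; last by rewrite mulr0n mulr0.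
  by rewrite mulr1n /tofrac_map /= -rmorphXn -rmorphM mul_polyC.
move/eqP; rewrite tofrac_eq0 => /eqP/polyP/(_ (val (enum_val a)).1).
rewrite coef0 coef_sum (bigD1 a) //= big1 ?addr0.
  by rewrite coefZ coefXn eqxx mulr1.
move=> b /andP[/eqP e2 nb]; rewrite coefZ coefXn; case: eqP => [e1|]; last by rewrite mulr0.
case/negP: nb; apply/eqP/enum_val_inj/val_inj.
by rewrite [LHS]surjective_pairing [RHS]surjective_pairing e1 e2.
Qed.

(** Ranks are unchanged over k(T), and a rank defect in degree a supplies the nonzero restricted
    kernel that [rank_cat_diff] asks for. *)
Lemma rank_cat_first_diff (k : fieldType) (mu : nat -> nat -> k) a c t :
  (\rank (cat mu a (c - a)) < 'C(a.+2, 2))%N ->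
  (0 < a <= t)%N -> (t + t <= c.+1)%N -> (t <= c)%N ->
  (\rank (cat mu t.-1 (c - t.-1)) <= \rank (cat mu t (c - t)) <=
   \rank (cat mu t.-1 (c - t.-1)) + a)%N.
Proof.
move=> /res_ker_neq0 nz h1 h2 h3.
have E r s : \rank (cat (fun i j => tofrac_map (mu i j)) r s) = \rank (cat mu r s).
  rewrite -(mxrank_map (@tofrac_map k)); congr (\rank _).
  by apply/matrixP => i j; rewrite !mxE.
by have := rank_cat_diff nz h1 h2 h3; rewrite !E.
Qed.

(** * Dimensions and bases *)

Section Bases.
Variables (k : fieldType) (V : lmodType k).
Implicit Types (S : V -> Prop).

Lemma has_basis_leq S d d' (b : 'I_d -> V) (b' : 'I_d' -> V) :
  has_basis S b -> has_basis S b' -> (d <= d')%N.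
Proof.
move=> [Sb fb _] [_ _ gb'].
have /fin_all_exists[A EA] i := gb' _ (Sb i).
pose M := \matrix_(i, j) A i j.
suff kM : kermx M = 0.
  by have := rank_leq_col M; have := mxrank_ker M; rewrite kM mxrank0; lia.
apply/row_matrixP => r; rewrite row0; apply/rowP => i; rewrite [RHS]mxE.
apply: (fb (fun i => row r (kermx M) 0 i)).
under eq_bigr => j _ do rewrite EA scaler_sumr.
rewrite exchange_big big1 //= => j _.
under eq_bigr => l _ do rewrite scalerA.
rewrite -scaler_suml [X in X *: _](_ : _ = 0) ?scale0r //.
have : row r (kermx M) *m M = 0 by rewrite -row_mul mulmx_ker row0.
move=> /rowP/(_ j); rewrite !mxE => E; rewrite -[RHS]E; apply: eq_bigr => l _.
by rewrite !mxE.
Qed.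

Lemma kdim_eq S d (b : 'I_d -> V) : has_basis S b -> kdim S = d.
Proof.
move=> bS; have ex : exists d', exists b' : 'I_d' -> V, has_basis S b'.
  by exists d, b.
have [b' b'S] := epsilon_spec (inhabits 0%N) _ ex.
by apply/eqP; rewrite eqn_leq (has_basis_leq b'S bS) (has_basis_leq bS b'S).
Qed.

Lemma has_basis_fin (J : finType) S (b : J -> V) :
    (forall i, S (b i)) ->
    (forall a : J -> k, \sum_i a i *: b i = 0 -> forall i, a i = 0) ->
    (forall v, S v -> exists a : J -> k, v = \sum_i a i *: b i) ->
  has_basis S (fun i : 'I_#|J| => b (enum_val i)).
Proof.
have sumE (a : J -> k) :
    \sum_i a i *: b i = \sum_(i < #|J|) a (enum_val i) *: b (enum_val i).
  rewrite (reindex (@enum_val J J)) //.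
  by apply: onW_bij; exact: enum_val_bij.
move=> Sb fb gb; split=> // [a E i|v /gb[a ->]].
  rewrite -[i]enum_valK; apply: (fb (fun x => a (enum_rank x))).
  by rewrite sumE -[RHS]E; apply: eq_bigr => j _; rewrite enum_valK.
by exists (fun i => a (enum_val i)); rewrite sumE.
Qed.

(** The generators satisfy the same linear relations as the rows of [M], so a maximal free family of
    rows selects a basis. *)
Lemma has_basis_rank S n p (v : 'I_n -> V) (M : 'M[k]_(n, p)) :
    (forall x, S x <-> exists a : 'rV[k]_n, x = \sum_i a 0 i *: v i) ->
    (forall a : 'rV[k]_n, \sum_i a 0 i *: v i = 0 <-> a *m M = 0) ->
  exists b : 'I_(\rank M) -> V, has_basis S b.
Proof.
move=> Sv kv; pose f := maxrankfun M; exists (fun i => v (f i)).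
have vE i : v i = \sum_j (delta_mx 0 i : 'rV_n) 0 j *: v j.
  rewrite (bigD1 i) //= mxE !eqxx scale1r big1 ?addr0 // => j ji.
  by rewrite mxE (negPf ji) andbF scale0r.
have subE (a : 'rV_(\rank M)) :
    \sum_i a 0 i *: v (f i) = \sum_i (a *m rowsub f 1%:M) 0 i *: v i.
  under eq_bigr => i _ do rewrite vE scaler_sumr.
  rewrite exchange_big; apply: eq_bigr => j _ /=.
  under eq_bigr => i _ do rewrite scalerA.
  rewrite -scaler_suml mxE; congr (_ *: _); apply: eq_bigr => i _.
  by rewrite !mxE eqxx /= [j == _]eq_sym.
split=> [i|a E i|x /Sv[a ->]].
- by apply/Sv; exists (delta_mx 0 (f i)); rewrite -vE.
- pose a' := \row_i a i.
  have : \sum_i a' 0 i *: v (f i) = 0.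
    by rewrite -[RHS]E; apply: eq_bigr => j _; rewrite mxE.
  rewrite subE => /kv; rewrite -mulmxA mul_rowsub_mx mul1mx => a'0.
  have /row_free_inj inj := maxrowsub_free M.
  have /rowP/(_ i) : a' = 0 by apply: inj; rewrite mul0mx.
  by rewrite !mxE.
- have /submxP[D ED] : (a *m M <= rowsub f M)%MS by rewrite eq_maxrowsub submxMl.
  exists (fun i => D 0 i); rewrite subE; apply/eqP; rewrite -subr_eq0 -sumrB.
  have -> : \sum_i (a 0 i *: v i - (D *m rowsub f 1%:M) 0 i *: v i) =
      \sum_i (a - D *m rowsub f 1%:M) 0 i *: v i.
    by apply: eq_bigr => i _; rewrite -scalerBl [in RHS]mxE [in RHS]mxE.
  by apply/eqP/kv; rewrite mulmxBl ED -mulmxA mul_rowsub_mx mul1mx subrr.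
Qed.

(** The last generator is kept or dropped according to whether it lies in the span of the others,
    decided classically. *)
Lemma has_basis_span S n (v : 'I_n -> V) :
    (forall x, S x <-> exists a : 'I_n -> k, x = \sum_i a i *: v i) ->
  exists d (b : 'I_d -> V), has_basis S b.
Proof.
have extE m (b : 'I_m -> V) y (a : 'I_m.+1 -> k) :
    \sum_i a i *: oapp b y (unlift ord_max i) =
    a ord_max *: y + \sum_i a (lift ord_max i) *: b i.
  rewrite (bigD1_ord ord_max) //= unlift_none; congr (_ + _).
  by apply: eq_bigr => i _; rewrite liftK.
elim: n => [|n IH] in S v * => Sv.
  exists 0%N, v; split=> [[]|a _ []|x /Sv] //.
pose v' i := v (lift ord_max i).
pose S' x := exists a : 'I_n -> k, x = \sum_i a i *: v' i.
have [d [b [S'b fb gb]]] : exists d (b : 'I_d -> V), has_basis S' b.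
  exact: (IH S' v' (fun x => iff_refl _)).
have SE x : S x <-> exists c y, S' y /\ x = c *: v ord_max + y.
  split=> [/Sv[a ->]|[c [_ [[a ->] ->]]]].
    exists (a ord_max); eexists; split; last by rewrite (bigD1_ord ord_max).
    by exists (fun i => a (lift ord_max i)).
  apply/Sv; exists (fun i => oapp a c (unlift ord_max i)).
  rewrite (bigD1_ord ord_max) //= unlift_none; congr (_ + _).
  by apply: eq_bigr => i _; rewrite liftK.
have S'S x : S' x -> S x.
  by move=> S'x; apply/SE; exists 0, x; rewrite scale0r add0r.
have Svm : S (v ord_max).
  apply/SE; exists 1, 0; rewrite scale1r addr0; split=> //.
  by exists (fun=> 0); rewrite big1 // => i _; rewrite scale0r.
case: (excluded_middle_informative (S' (v ord_max))) => [S'm|nS'm].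
  exists d, b; split=> // [i|x /SE[c [y [S'y ->]]]]; first exact/S'S.
  have [a ->] := gb _ S'y; have [a' ->] := gb _ S'm.
  exists (fun i => c * a' i + a i); rewrite scaler_sumr -big_split /=.
  by apply: eq_bigr => i _; rewrite scalerDl scalerA.
exists d.+1, (fun i => oapp b (v ord_max) (unlift ord_max i)).
split=> [i|a|x /SE[c [y [S'y ->]]]].
- by case: (unliftP ord_max i) => [j|] _ /=; [exact/S'S|].
- rewrite extE => E.
  have am : a ord_max = 0.
    apply/eqP/negPn/negP => nz; apply: nS'm.
    move/eqP: E; rewrite addr_eq0 => /eqP/(congr1 ( *:%R (a ord_max)^-1)).
    rewrite scalerA mulVf // scale1r scalerN -scaleNr scaler_sumr => ->.
    elim/big_ind: _ => [|_ _ [ax ->] [ay ->]|i _].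
    + by exists (fun=> 0); rewrite big1 // => i _; rewrite scale0r.
    + exists (fun i => ax i + ay i); rewrite -big_split; apply: eq_bigr => i _.
      by rewrite scalerDl.
    + have [ai ->] := S'b i; eexists; rewrite scalerA scaler_sumr.
      by apply: eq_bigr => j _; rewrite scalerA.
  move: E; rewrite am scale0r add0r => /fb a0 i.
  by case: (unliftP ord_max i) => [j ->|->//]; exact: a0.
- have [a ->] := gb _ S'y; exists (fun i => oapp a c (unlift ord_max i)).
  rewrite extE unlift_none; congr (_ + _).
  by apply: eq_bigr => i _; rewrite liftK.
Qed.

End Bases.

(** * Macaulay duality for the graded quotient *)

(** The exponent of z is what is missing to degree t; the truncated subtraction is exact on
    [mon t]. *)
Definition expo (t : nat) (p : nat * nat) : 'X_{1..3} :=
  [multinom nth 0%N [:: p.1; p.2; t - p.1 - p.2]%N i | i < 3].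

Lemma mdeg_expo t p : (p.1 + p.2 <= t)%N -> mdeg (expo t p) = t.
Proof.
by move=> h; rewrite mdegE !big_ord_recl big_ord0 !mnmE /=; lia.
Qed.

Lemma expo_surj (n : 'X_{1..3}) :
  exists m : mon (mdeg n), n = expo (mdeg n) (val m).
Proof.
have E : mdeg n = (n ord0 + (n (lift ord0 ord0) + n ord_max))%N.
  rewrite mdegE !big_ord_recl big_ord0 addn0.
  by congr (_ + (_ + n _))%N; apply/val_inj.
have h : (n ord0 + n (lift ord0 ord0) <= mdeg n)%N by rewrite E; lia.
exists (mkmon h); apply/mnmP => i; rewrite mnmE /=.
case: i => [[|[|[|]]]] //= Hi; rewrite ?E ?addKn; by congr (n _); apply/val_inj.
Qed.

Lemma expo_inj t : injective (fun m : mon t => expo t (val m)).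
Proof.
move=> m m' /mnmP E; apply/val_inj.
have := E ord0; have := E (lift ord0 ord0); rewrite !mnmE /=.
by case: (\val m) (\val m') => [i j] [i' j'] /= -> ->.
Qed.

Lemma expoD t u p q : (p.1 + p.2 <= t)%N -> (q.1 + q.2 <= u)%N ->
  (expo t p + expo u q)%MM = expo (t + u) (p.1 + q.1, p.2 + q.2)%N.
Proof.
move=> hp hq; apply/mnmP => i; rewrite mnmDE !mnmE.
by case: i => [[|[|[|]]]] //= _; lia.
Qed.

Section Homogeneous.
Variable k : fieldType.

Lemma dhomog_expo t (p : {mpoly k[3]}) : p \is t.-homog ->
  p = \sum_(m : mon t) p@_(expo t (val m)) *: 'X_[expo t (val m)].
Proof.
move=> hp; apply/mpolyP => n; rewrite raddf_sum /=.
under eq_bigr => m _ do rewrite mcoeffZ mcoeffX.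
have [dn|dn] := eqVneq (mdeg n) t; last first.
  rewrite (dhomog_nemf_coeff hp dn) big1 // => m _.
  case: eqP => [e|_]; last by rewrite mulr0.
  by case/negP: dn; rewrite -e mdeg_expo ?monP.
case: (expo_surj n); rewrite dn => m ->.
rewrite (bigD1 m) //= eqxx mulr1 big1 ?addr0 // => m' nm.
by rewrite (inj_eq (@expo_inj t)) (negPf nm) mulr0.
Qed.

Lemma sum_expo_homog t (a : mon t -> k) :
  \sum_m a m *: 'X_[expo t (val m)] \is [in k[3], t.-homog].
Proof.
by apply: rpred_sum => m _; rewrite rpredZ // dhomogX /= mdeg_expo ?monP.
Qed.

End Homogeneous.

Lemma sum_tagged (V : nmodType) n (h : 'I_n -> nat)
    (F : {t : 'I_n & 'I_(h t)} -> V) :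
  \sum_x F x = \sum_t \sum_i F (existT (fun t => 'I_(h t)) t i).
Proof.
rewrite (@sig_big_dep _ _ _ _ (fun t => 'I_(h t)) xpredT (fun=> xpredT)
  (fun t i => F (existT (fun t => 'I_(h t)) t i))).
by apply: eq_bigr => -[t i].
Qed.

Section Bridge.
Variables (k : fieldType) (I : idealr {mpoly k[3]}).
Hypothesis hI : homogeneous_ideal I.
Local Notation Q := {ideal_quot I}.
Local Notation R := {mpoly k[3]}.

Lemma pi_eq0 (p : R) : \pi_Q p = 0 <-> p \in I.
Proof.
by rewrite -[0](rmorph0 \pi_Q); split=> [/eqP|h]; [|apply/eqP];
  rewrite -Quotient.idealrBE subr0.
Qed.

Lemma pi_scale (c : k) (p : R) : c *: \pi_Q p = \pi_Q (c *: p).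
Proof. by rewrite -mul_mpolyC rmorphM. Qed.

Lemma pi_sum (J : finType) (a : J -> k) (p : J -> R) :
  \sum_i a i *: \pi_Q (p i) = \pi_Q (\sum_i a i *: p i).
Proof.
by elim/big_rec2: _ => [|i x q _ ->]; rewrite ?rmorph0 // pi_scale rmorphD.
Qed.

Lemma idealZ (c : k) (p : R) : p \in I -> c *: p \in I.
Proof. by move=> h; rewrite -mul_mpolyC idealMr. Qed.

Lemma pi_surj (x : Q) : exists p : R, x = \pi_Q p.
Proof. by exists (repr x); rewrite reprK. Qed.

Lemma graded_span t (x : Q) : graded_piece t x <->
  exists a : mon t -> k, x = \sum_m a m *: \pi_Q 'X_[expo t (val m)].
Proof.
split=> [[p hp ->]|[a ->]].
  by exists (fun m => p@_(expo t (val m))); rewrite pi_sum -dhomog_expo.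
by exists (\sum_m a m *: 'X_[expo t (val m)]); rewrite ?pi_sum // sum_expo_homog.
Qed.

Lemma sum_enum (V : lmodType k) (J : finType) (a : J -> k) (v : J -> V) :
  \sum_i a i *: v i = \sum_(i < #|J|) a (enum_val i) *: v (enum_val i).
Proof. by rewrite (reindex (@enum_val J J)) //; apply/onW_bij/enum_val_bij. Qed.

Lemma sum_enum_rank (V : lmodType k) (J : finType) (a : 'I_#|J| -> k) (v : J -> V) :
  \sum_i a (enum_rank i) *: v i = \sum_i a i *: v (enum_val i).
Proof. by rewrite sum_enum; apply: eq_bigr => i _; rewrite enum_valK. Qed.

Lemma graded_span_ord t (x : Q) : graded_piece t x <->
  exists a : 'I_#|mon t| -> k,
    x = \sum_i a i *: \pi_Q 'X_[expo t (val (enum_val i))].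
Proof.
rewrite graded_span; split=> [[a ->]|[a ->]].
  by exists (fun i => a (enum_val i)); rewrite sum_enum.
by exists (fun m => a (enum_rank m)); rewrite sum_enum_rank.
Qed.

Lemma hilb_eq0 (t : nat) :
  hilb I t = 0%N <-> forall p : R, p \is t.-homog -> p \in I.
Proof.
split=> [h0 p hp|h].
  (* [kdim] is unspecified in the absence of a basis, so one must be produced before h_t = 0 carries
     information. *)
  have [d [b bS]] := has_basis_span (@graded_span_ord t).
  move: h0; rewrite /= (kdim_eq bS) => d0; subst d.
  have [_ _ /(_ (\pi_Q p))] := bS; case; first by exists p.
  by move=> a; rewrite big_ord0 => /pi_eq0.
rewrite /=; apply: (@kdim_eq _ _ _ 0 (fun=> 0)); split=> [[]|a _ []|x [p hp ->]] //.
by exists (fun=> 0); rewrite big_ord0; apply/pi_eq0/h.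
Qed.

Lemma ideal_homog_sub (t u : nat) (p q : R) : t != u ->
  p \is t.-homog -> q \is u.-homog -> p - q \in I -> p \in I.
Proof.
move=> tu hp hq /(hI t); rewrite linearB /= pihomog_dE // (pihomog_ne0 _ hq) ?subr0 //.
by rewrite eq_sym.
Qed.

Lemma pi_eq (p q : R) : \pi_Q p = \pi_Q q <-> p - q \in I.
Proof.
by split=> [/eqP|h]; [rewrite -Quotient.idealrBE | apply/eqP; rewrite -Quotient.idealrBE].
Qed.

Lemma socleE (p : R) : socle (\pi_Q p) <-> forall i, 'X_i * p \in I.
Proof.
by split=> h i; have := h i; rewrite -rmorphM => /pi_eq0.
Qed.

(** Both classes are multiples of one socle generator, and the factor for w is invertible since w is
    not in I. *)
Lemma socle_line (w p : R) : (exists s : 'I_1 -> Q, has_basis (@socle _ _ I) s) ->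
  w \notin I -> socle (\pi_Q w) -> socle (\pi_Q p) ->
  exists l, p - l *: w \in I.
Proof.
move=> [s [_ _ gs]] wI /gs[a]; rewrite big_ord1 => Ew /gs[b]; rewrite big_ord1 => Ep.
have az : a ord0 != 0.
  apply: contraNneq wI => a0; move: Ew; rewrite a0 scale0r => Ew.
  by apply/pi_eq0.
exists (b ord0 / a ord0); apply/pi_eq; rewrite -pi_scale Ew.
by apply: etrans Ep _; rewrite scalerA divfK.
Qed.

(** * The perfect pairing into the socle degree c *)

Section Dual.
Variable c : nat.
Hypothesis htop : forall t (p : R), (c < t)%N -> p \is t.-homog -> p \in I.
Hypothesis hsoc : exists s : 'I_1 -> Q, has_basis (@socle _ _ I) s.
Variable w : R.
Hypotheses (hw : w \is c.-homog) (wI : w \notin I).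

Lemma top_socle (p : R) : p \is c.-homog -> socle (\pi_Q p).
Proof.
move=> hp; apply/socleE => i; apply: (htop (ltnSn c)); rewrite -[c.+1]add1n.
by apply: dhomogM => //; rewrite dhomogX /= mdeg1.
Qed.

(** The socle is the line of w, which sits in degree c, so homogeneity of I leaves no socle in lower
    degrees. *)
Lemma socle_deg t (p : R) : (t < c)%N -> p \is t.-homog ->
  (forall i, 'X_i * p \in I) -> p \in I.
Proof.
move=> tc hp /socleE sp; have [l hl] := socle_line hsoc wI (top_socle hw) sp.
have lw : l *: w \is c.-homog by exact: rpredZ.
by apply: ideal_homog_sub hp lw hl; rewrite neq_ltn tc.
Qed.

(** A nonzero class below degree c is not in the socle, so some variable keeps it nonzero; iterating
    d times yields a monomial. *)
Lemma pairing_nondegenerate d t (p : R) : (t + d)%N = c -> p \is t.-homog -> p \notin I ->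
  exists m : mon d, p * 'X_[expo d (val m)] \notin I.
Proof.
elim: d => [|d IH] in t p * => td hp pI.
  exists (@mkmon 0 0 0 isT); rewrite (_ : expo _ _ = 0%MM) ?mpolyX0 ?mulr1 //.
  by apply/eqP; rewrite -mdeg_eq0 mdeg_expo.
have [i Xi] : exists i, 'X_i * p \notin I.
  apply/existsP; apply: contraNT pI; rewrite negb_exists => /forallP h.
  apply: (socle_deg _ hp) => [|i]; first lia.
  by rewrite -[_ \in _]negbK.
have hX : 'X_i * p \is t.+1.-homog.
  by rewrite -[t.+1]add1n; apply: dhomogM => //; rewrite dhomogX /= mdeg1.
have td' : (t.+1 + d)%N = c by lia.
have {IH} [m Hm] := IH _ _ td' hX Xi.
have [m' Em'] := expo_surj (expo d (val m) + U_(i))%MM.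
have dm : mdeg (expo d (val m) + U_(i))%MM = d.+1.
  by rewrite mdegD mdeg1 mdeg_expo ?monP ?addn1.
rewrite dm in m' Em'; exists m'; rewrite -Em' mpolyXD.
by rewrite mulrA mulrC mulrA.
Qed.

Lemma dual_functional : exists mu : nat -> nat -> k,
  forall m : mon c, 'X_[expo c (val m)] - mu (val m).1 (val m).2 *: w \in I.
Proof.
have/fin_all_exists[l Hl] : forall m : mon c,
    exists a, 'X_[expo c (val m)] - a *: w \in I.
  move=> m; apply: socle_line hsoc wI (top_socle hw) _.
  by apply: top_socle; rewrite dhomogX /= mdeg_expo ?monP.
(* Pairs with i + j > c name no monomial of degree c and get the default 0. *)
exists (fun i j => oapp l 0 (insub (i, j))) => m.
by rewrite -surjective_pairing valK.
Qed.

Variable mu : nat -> nat -> k.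
Hypothesis hmu :
  forall m : mon c, 'X_[expo c (val m)] - mu (val m).1 (val m).2 *: w \in I.

Lemma scale_top_ideal l : (l *: w \in I) = (l == 0).
Proof.
have [->|l0] := eqVneq l 0; first by rewrite scale0r rpred0.
apply/negbTE; apply: contra wI => /(idealZ l^-1).
by rewrite scalerA mulVf // scale1r.
Qed.

(** The entries of [a *m cat mu t (c - t)] are the values mu (p q) at the monomials q of degree c -
    t; by nondegeneracy they all vanish only for p in I. *)
Lemma ideal_cat t (a : 'rV[k]_#|mon t|) : (t <= c)%N ->
  \sum_i a 0 i *: 'X_[expo t (val (enum_val i))] \in I <->
  a *m cat mu t (c - t) = 0.
Proof.
move=> tc; set p := \sum_i _.
have pm (n : mon (c - t)) : p * 'X_[expo (c - t) (val n)] -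
    (a *m cat mu t (c - t)) 0 (enum_rank n) *: w \in I.
  rewrite mulr_suml mxE scaler_suml -sumrB; apply: rpred_sum => i _.
  rewrite mxE -scalerA -scalerAl -scalerBr; apply: idealZ.
  rewrite -mpolyXD expoD ?monP // enum_rankK.
  set m := (_, _); have mP : (m.1 + m.2 <= c)%N.
    by have := monP (enum_val i); have := monP n; rewrite /m /=; lia.
  by have := hmu (mkmon mP); rewrite /= subnKC.
have memE (n : mon (c - t)) : (p * 'X_[expo (c - t) (val n)] \in I) =
    ((a *m cat mu t (c - t)) 0 (enum_rank n) == 0).
  rewrite -scale_top_ideal; apply/idP/idP => h.
    by rewrite -(subKr (p * 'X_[expo (c - t) (val n)]) (_ *: w)) rpredB.
  by rewrite -[X in X \in I](subrK ((a *m cat mu t (c - t)) 0 (enum_rank n) *: w)) rpredD.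
have hp : p \is t.-homog.
  by apply: rpred_sum => i _; rewrite rpredZ // dhomogX /= mdeg_expo ?monP.
split=> [pI|a0].
  apply/rowP => j; rewrite [RHS]mxE -[j]enum_valK; apply/eqP.
  by rewrite -memE mulrC idealMr.
apply/negPn/negP => /(pairing_nondegenerate (subnKC tc) hp)[n].
by rewrite memE a0 mxE eqxx.
Qed.

Lemma graded_basis t : (t <= c)%N ->
  exists b : 'I_(\rank (cat mu t (c - t))) -> Q, has_basis (graded_piece t) b.
Proof.
move=> tc; apply: (has_basis_rank (v := fun i => \pi_Q 'X_[expo t (val (enum_val i))])).
  move=> x; rewrite graded_span_ord; split=> [[a ->]|[a ->]].
    exists (\row_i a i); rewrite !pi_sum; congr (\pi_Q _).
    by apply: eq_bigr => i _; rewrite mxE.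
  by exists (fun i => a 0 i).
by move=> a; rewrite pi_sum pi_eq0 ideal_cat.
Qed.

Lemma hilb_rank (t : nat) : (t <= c)%N ->
  hilb I t = \rank (cat mu t (c - t)).
Proof. by move=> /graded_basis[b bS]; exact: kdim_eq bS. Qed.

(** The bases of the graded pieces up to degree c, indexed together by dependent pairs, form a basis
    of R/I. *)
Lemma mult_sum : artinian_mult I = (\sum_(t < c.+1) hilb I t)%N.
Proof.
pose h (t : 'I_c.+1) := \rank (cat mu t (c - t)).
have /fin_all_exists[b bS] (t : 'I_c.+1) :
    exists b : 'I_(h t) -> Q, has_basis (graded_piece t) b.
  exact: (graded_basis (ltn_ord t)).
pose J : finType := {t : 'I_c.+1 & 'I_(h t)}.
pose tg t (i : 'I_(h t)) : J := existT _ t i.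
have -> : (\sum_(t < c.+1) hilb I t)%N = #|J|.
  rewrite card_tagged sumnE big_map big_enum; apply: eq_bigr => t _.
  by rewrite card_ord hilb_rank // -ltnS.
have /fin_all_exists[P HP] (x : J) : exists p : R,
    p \is (tag x).-homog /\ b (tag x) (tagged x) = \pi_Q p.
  by have [/(_ (tagged x))[p hp ->] _ _] := bS (tag x); exists p.
have PE (t : 'I_c.+1) (a : J -> k) :
    \sum_i a (tg t i) *: b t i = \pi_Q (\sum_i a (tg t i) *: P (tg t i)).
  rewrite -pi_sum; apply: eq_bigr => i _.
  by have [_ /= ->] := HP (tg t i).
apply: kdim_eq (has_basis_fin (b := fun x => \pi_Q (P x)) _ _ _) => // [a|v _].
  rewrite pi_sum => /pi_eq0 aI [t i].
  have [_ fb _] := bS t; apply: (fb (fun i => a (tg t i))).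
  (* By homogeneity the degree t component of the relation is itself a relation, among the basis
     elements of degree t only. *)
  rewrite PE; apply/pi_eq0; have := hI t aI; rewrite linear_sum /=.
  rewrite (eq_bigr (fun x : J => if tag x == t then a x *: P x else 0)) => [|x _].
    rewrite sum_tagged /=.
    rewrite (bigD1 t) //= eqxx [X in _ + X]big1 ?addr0 // => s /negPf st.
    by rewrite big1 // => j _; rewrite st.
  rewrite linearZ /=; have [hP _] := HP x; case: eqP => [tx|/eqP tx].
    by rewrite pihomog_dE // -tx.
  by rewrite (pihomog_ne0 tx) // scaler0.
have [p ->] := pi_surj v.
rewrite (pihomog_partitionE (leqnn (mmeasure mdeg p))) rmorph_sum /=.
elim/big_ind: _ => [|_ _ [a1 ->] [a2 ->]|d _].
- by exists (fun=> 0); rewrite big1 // => x _; rewrite scale0r.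
- exists (fun x => a1 x + a2 x); rewrite -big_split /=.
  by apply: eq_bigr => x _; rewrite scalerDl.
have [dc|cd] := leqP d c; last first.
  exists (fun=> 0); rewrite pi_sum big1; last by move=> x _; rewrite scale0r.
  by rewrite rmorph0; apply/pi_eq0/(htop cd)/pihomogP.
pose t : 'I_c.+1 := Ordinal (dc : (d < c.+1)%N).
have [_ _ /(_ (\pi_Q (pihomog mdeg d p)))[]] := bS t.
  by exists (pihomog mdeg d p) => //; exact: pihomogP.
(* Coordinates in degree t are extended by 0 to the other degrees; the cast only transports the
   index along [tag x = t]. *)
move=> a' ->; pose a (x : J) := if tag x =P t is ReflectT e
  then a' (cast_ord (congr1 h e) (tagged x)) else 0.
have -> : \sum_i a' i *: b t i = \sum_i a (tg t i) *: b t i.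
  apply: eq_bigr => i _; congr (_ *: _); rewrite /a /=.
  case: eqP => // e; congr a'; exact/val_inj.
exists a; rewrite PE pi_sum; congr (\pi_Q _).
rewrite sum_tagged.
rewrite (bigD1 t) //= [X in _ = _ + X]big1 ?addr0 // => s /eqP st.
rewrite big1 // => j _; rewrite /a /=; case: eqP => // _; exact: scale0r.
Qed.

End Dual.

End Bridge.

(** * Numerical estimates *)

Lemma sum_telescope_ge (F x : nat -> int) l r : (l <= r)%N ->
  (forall j, (l <= j < r)%N -> F j.+1 - F j <= x j) ->
  F r - F l <= \sum_(l <= j < r) x j.
Proof. by move=> lr h; rewrite -telescope_sumr //; apply: ler_sum_nat. Qed.

Lemma sum_telescope_le (F x : nat -> int) l r : (l <= r)%N ->
  (forall j, (l <= j < r)%N -> x j <= F j.+1 - F j) ->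
  \sum_(l <= j < r) x j <= F r - F l.
Proof. by move=> lr h; rewrite -telescope_sumr //; apply: ler_sum_nat. Qed.

(** * Cubic bounds for the weighted sum of a first difference g *)

Section Core.
Variables (s a b : nat) (g : nat -> int).
Hypotheses (a1 : (0 < a)%N) (as2 : (2 * a < s)%N) (ab : (a < b)%N).
Hypothesis (abs : (a + b <= s)%N).
Hypothesis g_lt : forall j, (j < a)%N -> g j = j.+1%:Z.
Hypothesis g_anti : forall i j, (i + j + 2 = s)%N -> g i = - g j.
Hypothesis g_bnd : forall j, (a <= j)%N -> (2 * j + 2 <= s)%N -> 0 <= g j <= a%:Z.
Hypothesis g_conc : forall j, (a <= j.+1)%N -> (j.+2 < b)%N ->
  g j.+2 - g j.+1 <= g j.+1 - g j.

Let m := (s %/ 2)%N.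
(** The weight of [g j] in e, as computed in [sum_diff_weight]; it is twice the signed distance from
    j to the centre (s - 2)/2. *)
Let W (j : nat) : int := s%:Z - 2 - 2 * j%:Z.
Let E (n : nat) : int := \sum_(0 <= j < n) g j * W j.

(** Below a the values g j = j + 1 are known and sum to a closed form; only the part from a on needs
    estimating. *)
Lemma E_split n : (a <= n)%N ->
  6 * E n = a%:Z * (a%:Z + 1) * (3 * s%:Z - 4 * a%:Z - 2)
            + 6 * \sum_(a <= j < n) g j * W j.
Proof.
move=> an; rewrite /E (big_cat_nat (leq0n a) an) /= mulrDr; congr (_ + _).
have : forall k, (k <= a)%N -> 6 * \sum_(0 <= j < k) g j * W j =
    k%:Z * (k%:Z + 1) * (3 * s%:Z - 4 * k%:Z - 2).
  elim=> [|k IH] ka; first by rewrite big_geq // mulr0 !mul0r.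
  rewrite big_nat_recr //= mulrDr IH ?(ltnW ka) // g_lt // /W !intS; ring.
exact.
Qed.

Lemma g_pred : g a.-1 = a%:Z. Proof. by rewrite g_lt prednK. Qed.

Lemma conc_le i j : (a <= i.+1)%N -> (i <= j)%N -> (j.+1 < b)%N ->
  g j.+1 - g j <= g i.+1 - g i.
Proof.
move=> ai; elim: j => [|j IH] ij jb; first by rewrite (_ : i = 0%N) //; lia.
have [->//|nij] := eqVneq i j.+1.
apply: le_trans (g_conc _ _) (IH _ _); lia.
Qed.

(* Slope of the chord from a - 1. *)
Lemma slope_left j : (a <= j.+1)%N -> (j.+1 < b)%N ->
  (j%:Z + 2 - a%:Z) * (g j.+1 - g j) <= g j.+1 - a%:Z.
Proof.
elim: j => [|j IH] aj jb.
  have a1' : a = 1%N by lia.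
  by have := g_pred; rewrite a1' /= => ->; lia.
have [e|n] := eqVneq a j.+2.
  by have := g_pred; rewrite e /= => ->; lia.
have h1 : (a <= j.+1)%N by lia.
have := IH h1 (ltnW jb); have := g_conc h1 jb.
set x := g j.+2; set y := g j.+1; set z := g j => h2 h3.
have -> : (j.+1%:Z + 2 - a%:Z) * (x - y) = (j%:Z + 2 - a%:Z) * (x - y) + (x - y) by lia.
have h4 : (j%:Z + 2 - a%:Z) * (x - y) <= (j%:Z + 2 - a%:Z) * (y - z).
  by apply: ler_wpM2l => //; lia.
lia.
Qed.

(** With x = s - 1 - 2 j, which drops by 2 at each step, W j = x - 1 and x^3 - x loses 6 (x -
    1)^2. *)
Lemma W_tele j : 6 * (W j * W j) =
  - ((s%:Z - 1 - 2 * j.+1%:Z) ^+ 3 - (s%:Z - 1 - 2 * j.+1%:Z))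
  - - ((s%:Z - 1 - 2 * j%:Z) ^+ 3 - (s%:Z - 1 - 2 * j%:Z)).
Proof. by rewrite /W intS; ring. Qed.

Lemma W_ge0 j : (j < m)%N -> 0 <= W j.
Proof. rewrite /W /m; lia. Qed.

Lemma lower_small : (2 * b <= s)%N -> s%:Z * a%:Z * b%:Z <= 6 * E m.
Proof.
move=> bs.
(* Slopes decrease up to b - 1, where g is still nonnegative. *)
have right j : (a <= j.+1)%N -> (j.+1 < b)%N ->
    - g j.+1 <= (b%:Z - j%:Z - 2) * (g j.+1 - g j).
  move=> aj jb.
  have [k ek] : exists k, (b = j + k + 2)%N by exists (b - j - 2)%N; lia.
  have H : forall i, (i <= k)%N -> g (j + i).+1 - g j.+1 <= i%:Z * (g j.+1 - g j).
    elim=> [|i IH] ik; first by rewrite addn0 mul0r subrr.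
    have := IH (ltnW ik); have : g (j + i).+2 - g (j + i).+1 <= g j.+1 - g j.
      have -> : (j + i).+1 = (j + i.+1)%N by rewrite addnS.
      by apply: conc_le; lia.
    rewrite addnS intS mulrDl mul1r; lia.
  have := H k (leqnn _); have /andP[] : 0 <= g (j + k).+1 <= a%:Z by apply: g_bnd; lia.
  rewrite (_ : b%:Z - j%:Z - 2 = k%:Z); lia.
(* g lies above the chord from (a - 1, a) to (b - 1, 0): the slope is eliminated between
   [slope_left] and [right]. *)
have key j : (a <= j < b)%N ->
    a%:Z * (b%:Z - 1 - j%:Z) <= (b%:Z - a%:Z) * g j.
  case: j => [|j] /andP[aj jb]; first lia.
  have h1 := slope_left aj jb; have h2 := right j aj jb.
  move: (g j.+1) (g j.+1 - g j) h1 h2 => x f h1 h2.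
  have p1 : 0 <= b%:Z - j%:Z - 2 by lia.
  have p2 : 0 <= j%:Z + 2 - a%:Z by lia.
  have := ler_wpM2l p1 h1; have := ler_wpM2l p2 h2.
  rewrite intS; lra.
have am : (a <= m)%N by rewrite /m; lia.
have bm : (b <= m)%N by rewrite /m; lia.
rewrite (E_split am) (big_cat_nat (ltnW ab) bm) /=.
have tail : 0 <= \sum_(b <= j < m) g j * W j.
  rewrite big_nat_cond; apply: sumr_ge0 => j /andP[/andP[bj jm] _].
  apply: mulr_ge0; last exact: W_ge0.
  by have /andP[] : 0 <= g j <= a%:Z by apply: g_bnd; move: jm; rewrite /m; lia.
(* A discrete antiderivative of 6 a (b - 1 - j) W j, vanishing at j = b. *)
pose F (j : nat) : int := - a%:Z *
  ((b%:Z - j%:Z) * (b%:Z - j%:Z - 1) * (3 * s%:Z - 6 * b%:Z + 4 * (b%:Z - j%:Z) - 2)).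
have head : F b - F a <= \sum_(a <= j < b) 6 * (b%:Z - a%:Z) * (g j * W j).
  apply: sum_telescope_ge => [|j jab]; first exact: ltnW.
  have jm : (j < m)%N by lia.
  have := ler_wpM2r (W_ge0 jm) (key _ jab).
  rewrite /F /W intS; lra.
have {head} : a%:Z * (b%:Z - a%:Z - 1) * (3 * s%:Z - 2 * b%:Z - 4 * a%:Z - 2) <=
   6 * \sum_(a <= j < b) g j * W j.
  have p : 0 < b%:Z - a%:Z by lia.
  rewrite -(ler_pM2l p); move: head; rewrite -mulr_sumr /F; lra.
(* The chord bound exceeds s a b by exactly 2 a b (s - a - b). *)
have := mulr_ge0 (mulr_ge0 (_ : 0 <= a%:Z) (_ : 0 <= b%:Z)) (_ : 0 <= s%:Z - a%:Z - b%:Z).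
move=> /(_ isT isT) /(_ ltac:(lia)); lra.
Qed.

(** By antisymmetry the line through the values at m - 1 and m meets 0 at the centre, which is m - 1
    for even s and m - 1/2 for odd s. *)
Lemma slope_center_m : - 2 * g m = W m * (g m - g m.-1).
Proof.
have [o|e] := boolP (odd s).
  have -> : W m = - 1 by rewrite /W /m; lia.
  by have -> : g m = - g m.-1; [apply: g_anti; rewrite /m|]; lia.
have -> : W m = - 2 by rewrite /W /m; lia.
by have : g m.-1 = - g m.-1; [apply: g_anti; rewrite /m|]; lia.
Qed.

(** By concavity, descending from m, the line through the values at j - 1 and j is nonnegative at
    the centre. *)
Lemma slope_center j : (a <= j <= m)%N -> (s < 2 * b)%N ->
  - 2 * g j <= W j * (g j - g j.-1).
Proof.
move=> /andP[aj jm] sb; have [k ek] : exists k, m = (j + k)%N by exists (m - j)%N; lia.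
elim: k j aj {jm} ek => [|k IH] j aj ek.
  by rewrite -[j]addn0 -ek slope_center_m.
have /IH/(_ _) : (a <= j.+1)%N by lia.
move=> /(_ ltac:(lia)) /= h1.
have h2 : g j.+1 - g j <= g j - g j.-1.
  by case: j aj ek {h1} => [|j] aj ek /=; [lia | apply: g_conc => //; rewrite /m in ek; lia].
have jm : (j < m)%N by lia.
have := ler_wpM2l (W_ge0 jm) h2; move: h1; rewrite /W intS; lra.
Qed.

Lemma lower_large : (s < 2 * b)%N -> s%:Z * a%:Z * b%:Z <= 6 * E m.
Proof.
move=> sb; have am : (a <= m)%N by rewrite /m; lia.
have mb : (m < b)%N by rewrite /m; lia.
(* Here the comparison chord runs from (a - 1, a) to the centre. *)
have key j : (a <= j < m)%N -> a%:Z * W j <= (s%:Z - 2 * a%:Z) * g j.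
  move=> /andP[aj jm]; have := @slope_center j; rewrite aj ltnW // => /(_ isT sb).
  case: j aj jm => [|j] aj jm /=; first lia.
  have jb : (j.+1 < b)%N by lia.
  have h1 := slope_left aj jb; have := ler_wpM2l (W_ge0 jm) h1.
  move: (g j.+1) (g j) => x y; rewrite /W intS.
  set f := x - y => h2 h3.
  have p : 0 <= j%:Z + 2 - a%:Z by lia.
  have := ler_wpM2l p h3; lra.
pose F (j : nat) : int := - a%:Z * ((s%:Z - 1 - 2 * j%:Z) ^+ 3 - (s%:Z - 1 - 2 * j%:Z)).
have head : F m - F a <= \sum_(a <= j < m) 6 * (s%:Z - 2 * a%:Z) * (g j * W j).
  apply: sum_telescope_ge => // j jam.
  have jm : (j < m)%N by lia.
  have := ler_wpM2r (W_ge0 jm) (key _ jam); have := W_tele j.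
  rewrite /F; move: (W j) => w e h.
  have -> : - a%:Z * ((s%:Z - 1 - 2 * j.+1%:Z) ^+ 3 - (s%:Z - 1 - 2 * j.+1%:Z)) -
     - a%:Z * ((s%:Z - 1 - 2 * j%:Z) ^+ 3 - (s%:Z - 1 - 2 * j%:Z)) = a%:Z * (6 * (w * w)).
    by rewrite e; ring.
  lra.
have Fm : F m = 0.
  rewrite /F; have [->|->] : s%:Z - 1 - 2 * m%:Z = 0 \/ s%:Z - 1 - 2 * m%:Z = - 1.
  - by rewrite /m; lia.
  - by rewrite expr0n subrr mulr0.
  - ring.
rewrite (E_split am).
have {head} : a%:Z * (s%:Z - 1 - 2 * a%:Z) * (s%:Z - 2 - 2 * a%:Z) <=
   6 * \sum_(a <= j < m) g j * W j.
  have p : 0 < s%:Z - 2 * a%:Z by lia.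
  rewrite -(ler_pM2l p); move: head; rewrite Fm -mulr_sumr /F; lra.
(* The excess over s a b is now exactly a s (s - a - b). *)
have := mulr_ge0 (mulr_ge0 (_ : 0 <= a%:Z) (_ : 0 <= s%:Z)) (_ : 0 <= s%:Z - a%:Z - b%:Z).
move=> /(_ isT isT) /(_ ltac:(lia)); lra.
Qed.

Lemma sum_W_le l r : (l <= r)%N ->
  4 * \sum_(l <= j < r) W j = (s%:Z - 1 - 2 * l%:Z) ^+ 2 - (s%:Z - 1 - 2 * r%:Z) ^+ 2.
Proof.
move=> lr; pose F (j : nat) : int := - (s%:Z - 1 - 2 * j%:Z) ^+ 2.
rewrite mulr_sumr (eq_bigr (fun j => F j.+1 - F j)) => [|j _].
  by rewrite telescope_sumr // /F; ring.
by rewrite /F /W intS; ring.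
Qed.

Lemma upper_small : (2 * b <= s)%N ->
  6 * E m <= (s%:Z - a%:Z) * (s%:Z - b%:Z) * s%:Z.
Proof.
move=> bs; have am : (a <= m)%N by rewrite /m; lia.
have : \sum_(a <= j < m) g j * W j <= a%:Z * \sum_(a <= j < m) W j.
  rewrite mulr_sumr; apply: ler_sum_nat => j /andP[aj jm].
  apply: ler_wpM2r; first exact: W_ge0.
  by have /andP[] : 0 <= g j <= a%:Z by apply: g_bnd; move: jm; rewrite /m; lia.
rewrite (E_split am); have := sum_W_le am.
move: (\sum_(a <= j < m) g j * W j) (\sum_(a <= j < m) W j) => x y e h.
have h2 : 4 * y <= (s%:Z - 1 - 2 * a%:Z) ^+ 2
  by rewrite e; have := sqr_ge0 (s%:Z - 1 - 2 * m%:Z); lra.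
have h3 : 0 <= a%:Z by [].
have h4 := ler_wpM2l h3 h2.
(* Once 2 (s - b) >= s is used through [h6], the remaining gap is this product plus a. *)
have h5 : 0 <= (s%:Z - 2 * a%:Z) * ((s%:Z - a%:Z) ^+ 2 + a%:Z ^+ 2).
  by apply: mulr_ge0; [lia | apply: addr_ge0; apply: sqr_ge0].
have h6 : 0 <= s%:Z * (s%:Z - a%:Z) * (s%:Z - 2 * b%:Z).
  by do 2?apply: mulr_ge0; lia.
lra.
Qed.

Lemma upper_large : (s < 2 * b)%N ->
  6 * E m <= (s%:Z - a%:Z) * (s%:Z - b%:Z) * s%:Z.
Proof.
move=> sb; have am : (a <= m)%N by rewrite /m; lia.
have mb : (m < b)%N by rewrite /m; lia.
have [d ed] : exists d, (s = b + d)%N by exists (s - b)%N; lia.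
have ad : (a <= d)%N by lia.
have dm : (d <= m)%N by rewrite /m; lia.
(* Concavity at the mirror index s - j - 4 is convexity at j, so g is linear where both apply. *)
have lin j : (d <= j.+1)%N -> (j.+2 < b)%N -> g j.+2 - g j.+1 = g j.+1 - g j.
  move=> dj jb; apply/eqP; rewrite eq_le g_conc //=; last lia.
  pose i := (s - j - 4)%N.
  have -> : g j.+2 = - g i by apply: g_anti; rewrite /i; lia.
  have -> : g j.+1 = - g i.+1 by apply: g_anti; rewrite /i; lia.
  have -> : g j = - g i.+2 by apply: g_anti; rewrite /i; lia.
  have := @g_conc i; rewrite -/i => /(_ ltac:(rewrite /i; lia) ltac:(rewrite /i; lia)).
  lia.
have slope j : (d <= j <= m)%N -> - 2 * g j = W j * (g d - g d.-1).
  move=> /andP[dj jm]; have fE : g j - g j.-1 = g d - g d.-1.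
    elim: j dj jm => [|j IH] dj jm; first by have -> : d = 0%N by lia.
    have [->//|nd] := eqVneq d j.+1.
    by rewrite -IH; [case: j dj jm nd {IH} => [|j] dj jm nd /=; [lia | apply: lin] | |]; lia.
  rewrite -fE; have [k ek] : exists k, m = (j + k)%N by exists (m - j)%N; lia.
  elim: k j dj {jm fE} ek => [|k IH] j dj ek.
    by rewrite -[j]addn0 -ek slope_center_m.
  have := IH j.+1 (leq_trans dj (leqnSn _)) ltac:(lia); rewrite /= /W intS.
  have : g j.+1 - g j = g j - g j.-1.
    case: j dj ek {IH} => [|j] dj ek /=; first lia.
    apply: lin; lia.
  move=> <-; lra.
have gd : g d.-1 <= a%:Z.
  have [->|nad] := eqVneq d a; first by rewrite g_pred.
  by have /andP[] : 0 <= g d.-1 <= a%:Z by apply: g_bnd; lia.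
(* The points j lie on the line from (d - 1, g (d - 1)) to the centre, and g (d - 1) <= a. *)
have key j : (d <= j < m)%N -> (s%:Z - 2 * d%:Z) * g j <= a%:Z * W j.
  move=> /andP[dj jm]; have := slope j; rewrite dj ltnW // => /(_ isT).
  have := slope d; rewrite leqnn dm => /(_ isT).
  have := ler_wpM2r (W_ge0 jm) gd.
  move: (g j) (g d) (g d.-1) => x y z h1 h2 h3.
  have : (s%:Z - 2 * d%:Z) * (- 2 * x) = W j * (- 2 * z).
    have e : (s%:Z - 2 * d%:Z) * (y - z) = - 2 * z by move: h2; rewrite /W; lra.
    by rewrite h3 mulrCA e.
  lra.
rewrite (E_split am) (big_cat_nat ad dm) /=.
have head : \sum_(a <= j < d) g j * W j <= a%:Z * \sum_(a <= j < d) W j.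
  rewrite mulr_sumr; apply: ler_sum_nat => j /andP[aj jd].
  apply: ler_wpM2r; first by apply: W_ge0; lia.
  by have /andP[] : 0 <= g j <= a%:Z by apply: g_bnd; lia.
have eW := sum_W_le ad.
pose F (j : nat) : int := - a%:Z * ((s%:Z - 1 - 2 * j%:Z) ^+ 3 - (s%:Z - 1 - 2 * j%:Z)).
have : \sum_(d <= j < m) 6 * (s%:Z - 2 * d%:Z) * (g j * W j) <= F m - F d.
  apply: sum_telescope_le => // j jdm.
  have jm : (j < m)%N by lia.
  have := ler_wpM2r (W_ge0 jm) (key _ jdm); have := W_tele j.
  rewrite /F; move: (W j) => w e h.
  have -> : - a%:Z * ((s%:Z - 1 - 2 * j.+1%:Z) ^+ 3 - (s%:Z - 1 - 2 * j.+1%:Z)) -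
     - a%:Z * ((s%:Z - 1 - 2 * j%:Z) ^+ 3 - (s%:Z - 1 - 2 * j%:Z)) = a%:Z * (6 * (w * w)).
    by rewrite e; ring.
  lra.
have -> : F m = 0.
  rewrite /F; have [->|->] : s%:Z - 1 - 2 * m%:Z = 0 \/ s%:Z - 1 - 2 * m%:Z = - 1.
  - by rewrite /m; lia.
  - by rewrite expr0n subrr mulr0.
  - ring.
rewrite -mulr_sumr => tail.
have {tail} : 6 * \sum_(d <= j < m) g j * W j <=
    a%:Z * (s%:Z - 1 - 2 * d%:Z) * (s%:Z - 2 - 2 * d%:Z).
  have p : 0 < s%:Z - 2 * d%:Z by lia.
  rewrite -(ler_pM2l p); move: tail; rewrite /F; lra.
have -> : b%:Z = s%:Z - d%:Z by lia.
move: (\sum_(a <= j < d) _) (\sum_(a <= j < d) _) (\sum_(d <= j < m) _)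
  head eW => y x z h1 h2 h3.
have h4 : 4 * x <= a%:Z * (4 * y) by lra.
rewrite h2 in h4.
have [e ee] : exists e : nat, d%:Z = a%:Z + e%:Z by exists (d - a)%N; lia.
have [q eq] : exists q : nat, s%:Z = 2 * d%:Z + q%:Z by exists (s - 2 * d)%N; lia.
(* With d = a + e and s = 2 d + q, this is exactly the gap between the two sides. *)
have : 0 <= e%:Z * (2 * a%:Z ^+ 2 + 4 * a%:Z * e%:Z + 4 * e%:Z ^+ 2 + a%:Z * q%:Z
                    + 4 * e%:Z * q%:Z + q%:Z ^+ 2).
  by rewrite mulr_ge0 // !addr_ge0 ?mulr_ge0.
move: h3 h4; rewrite eq ee; lra.
Qed.

End Core.

(** * From the third difference of h to the hypotheses on g *)

Section Numeric.
Variables (h : int -> nat) (c : nat).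
Local Notation H t := ((h t)%:Z).
Hypothesis h_neg : forall t, t < 0 -> h t = 0%N.
Hypothesis h_top : forall t, c%:Z < t -> h t = 0%N.
Hypothesis h_sym : forall t : nat, (t <= c)%N -> h t = h (c - t)%N.
Hypotheses (h0 : h 0 = 1%N) (h1 : h 1 = 3%N).
Hypothesis h_bin : forall t : nat, (t <= c)%N -> (h t <= 'C(t.+2, 2))%N.
Hypothesis h_diff : forall a t : nat, (h a < 'C(a.+2, 2))%N -> (0 < a <= t)%N ->
  (t + t <= c.+1)%N -> (t <= c)%N -> (h t.-1 <= h t <= h t.-1 + a)%N.

Lemma h_symz t : h t = h (c%:Z - t).
Proof.
have [t0|t0] := ltP t 0; first by rewrite h_neg // h_top //; lia.
have [tc|tc] := ltP c%:Z t; first by rewrite h_top // h_neg //; lia.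
case: t t0 tc => [t|t] // _ tc; rewrite h_sym; last lia.
congr h; lia.
Qed.

Lemma third_diff_anti t : third_diff h (c%:Z + 3 - t) = - third_diff h t.
Proof.
rewrite /third_diff (h_symz t) (h_symz (t - 1)) (h_symz (t - 2)) (h_symz (t - 3)).
have -> : c%:Z + 3 - t - 1 = c%:Z - (t - 2) by lia.
have -> : c%:Z + 3 - t - 2 = c%:Z - (t - 1) by lia.
have -> : c%:Z + 3 - t - 3 = c%:Z - t by lia.
have -> : c%:Z + 3 - t = c%:Z - (t - 3) by lia.
lia.
Qed.

Lemma bin2z n : ('C(n.+2, 2))%:Z * 2 = (n%:Z + 1) * (n%:Z + 2).
Proof.
have := bin_ffact n.+2 2; rewrite !ffactnS ffactn0 /= muln1 => e.
have -> : ('C(n.+2, 2))%:Z * 2 = ('C(n.+2, 2) * 2)%N%:Z by [].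
by rewrite e PoszM !intS; ring.
Qed.

Lemma sum_half (F : nat -> int) n : (n <= c.+1)%N ->
  (forall t, (t <= c)%N -> F t = F (c - t)%N) ->
  \sum_(0 <= t < c.+1) F t = \sum_(0 <= t < n) F t + \sum_(0 <= t < c.+1 - n) F t.
Proof.
move=> nc Fs; elim: n nc => [|n IH] nc.
  by rewrite subn0 [X in _ = X + _]big_geq // add0r.
rewrite IH ?(ltnW nc) // big_nat_recr //= -addrA; congr (_ + _).
have -> : (c.+1 - n = (c - n).+1)%N by lia.
by rewrite big_nat_recr //= subSS addrC -Fs.
Qed.

(** Summation by parts leaves twice the lower half of the sum of h plus a boundary term; symmetry
    folds this into the full sum. The boundary weight is 1 for odd s, where it supplies the middle
    term, and 0 for even s. *)
Lemma sum_diff_weight (m := ((c + 3) %/ 2)%N) :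
  \sum_(0 <= j < m) (H j%:Z - H (j%:Z - 1)) * ((c + 3)%N%:Z - 2 - 2 * j%:Z) =
  \sum_(0 <= t < c.+1) H t%:Z.
Proof.
have part n : \sum_(0 <= j < n.+1) (H j%:Z - H (j%:Z - 1)) *
    ((c + 3)%N%:Z - 2 - 2 * j%:Z) =
    H n%:Z * ((c + 3)%N%:Z - 2 - 2 * n%:Z) + 2 * \sum_(0 <= j < n) H j%:Z.
  elim: n => [|n IH].
    rewrite big_nat1 big_geq // (_ : h (0%:Z - 1) = 0%N); last exact: h_neg.
    by rewrite subr0; ring.
  rewrite big_nat_recr //= IH [in RHS]big_nat_recr //=.
  have -> : n.+1%:Z - 1 = n%:Z by lia.
  rewrite intS; ring.
have [n en] : exists n, m = n.+1 by exists m.-1; rewrite /m; lia.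
rewrite en part (@sum_half (fun t => H t%:Z) n); last 2 first.
- by rewrite /m in en; lia.
- by move=> t tc; rewrite h_sym.
have [o|e] := boolP (odd (c + 3)).
  have -> : (c + 3)%N%:Z - 2 - 2 * n%:Z = 1 by rewrite /m in en; lia.
  have -> : (c.+1 - n = n.+1)%N by rewrite /m in en; lia.
  by rewrite big_nat_recr //=; ring.
have -> : (c + 3)%N%:Z - 2 - 2 * n%:Z = 0 by rewrite /m in en; lia.
have -> : (c.+1 - n = n)%N by rewrite /m in en; lia.
ring.
Qed.

Lemma hilbert_bounds (n1 n2 N1 N2 : int) :
    is_min (fun t => third_diff h t < 0) n1 ->
    is_min (fun t => 0 < t /\ 0 < third_diff h t) n2 ->
    is_max (fun t => t <= c%:Z + 1 /\ third_diff h t < 0) N1 ->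
    is_max (fun t => 0 < third_diff h t) N2 ->
  n1 * n2 * (c%:Z + 3) <= 6 * \sum_(0 <= t < c.+1) H t%:Z <= N1 * N2 * (c%:Z + 3).
Proof.
move=> [p1 m1] [[n2_gt0 p2] m2] [[N1c P1] M1] [P2 M2].
have n1_gt0 : 0 < n1.
  have [//|n1_le0] := ltP 0 n1.
  move: p1; rewrite /third_diff (h_neg (t := n1 - 1)) ?(h_neg (t := n1 - 2))
    ?(h_neg (t := n1 - 3)); lia.
have [a ea] : exists a, n1 = Posz a by exists `|n1|%N; lia.
have [b eb] : exists b, n2 = Posz b by exists `|n2|%N; lia.
subst n1 n2.
have c_gt0 : (0 < c)%N.
  by have [] := posnP c => // c0; move: h1; rewrite h_top // c0.
have binz (t : nat) : (t <= c)%N -> 2 * H t <= (t%:Z + 1) * (t%:Z + 2).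
  by move=> /h_bin tb; have := bin2z t; lia.
(* Below a, the third difference is nonnegative and forces h_t up to the binomial bound [h_bin].
   Starting at -2, where the formula gives 0 as at -1, makes the recursion reach t = 1. *)
have full n : forall t : int, -2 <= t -> t <= n%:Z -> t < a%:Z ->
    2 * H t = (t + 1) * (t + 2).
  elim: n => [|n IH] t t_ge tn ta.
    have [->|[->|->]] : t = - 2 \/ t = - 1 \/ t = 0 by lia.
    - by rewrite h_neg.
    - by rewrite h_neg.
    - by rewrite h0.
  have [tn'|nt] := leP t n%:Z; first exact: IH.
  have et : t = n.+1%:Z by lia.
  have : 0 <= third_diff h t by rewrite leNgt; apply/negP => /m1; lia.
  have E1 : 2 * H (t - 1) = (t - 1 + 1) * (t - 1 + 2) by apply: IH; lia.
  have E2 : 2 * H (t - 2) = (t - 2 + 1) * (t - 2 + 2) by apply: IH; lia.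
  have E3 : 2 * H (t - 3) = (t - 3 + 1) * (t - 3 + 2) by apply: IH; lia.
  rewrite /third_diff => d3.
  have ge : (t + 1) * (t + 2) <= 2 * H t by lra.
  have pos : 0 < (t + 1) * (t + 2) by apply: mulr_gt0; lia.
  have tc : (n.+1 <= c)%N.
    by rewrite leqNgt; apply/negP => cn; move: ge; rewrite h_top ?et; lia.
  by have := binz _ tc; rewrite -et; lia.
have {}full t : -2 <= t -> t < a%:Z -> 2 * H t = (t + 1) * (t + 2).
  by move=> t2 ta; apply: (full `|t|%N) => //; lia.
have d3_lt t : 0 < t -> t < a%:Z -> third_diff h t = 0.
  move=> t0 ta; have := full t; have := full (t - 1); have := full (t - 2).
  have := full (t - 3).
  move=> /(_ ltac:(lia) ltac:(lia)) E3 /(_ ltac:(lia) ltac:(lia)) E2.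
  move=> /(_ ltac:(lia) ltac:(lia)) E1 /(_ ltac:(lia) ltac:(lia)) E0.
  by rewrite /third_diff; lra.
have lt_a : 2 * H a%:Z < (a%:Z + 1) * (a%:Z + 2).
  have := full (a%:Z - 1); have := full (a%:Z - 2); have := full (a%:Z - 3).
  move=> /(_ ltac:(lia) ltac:(lia)) E3 /(_ ltac:(lia) ltac:(lia)) E2.
  move=> /(_ ltac:(lia) ltac:(lia)) E1.
  by move: p1; rewrite /third_diff; lra.
have a_gt1 : (1 < a)%N.
  have [//|] := ltnP 1 a; move=> a1; have ea : a = 1%N by lia.
  by move: lt_a; rewrite ea h1.
have ab : (a < b)%N.
  rewrite ltnNge; apply/negP => ba; have [e|ne] := eqVneq a b.
    by move: p1 p2; rewrite e; lia.
  by move: p2; rewrite d3_lt //; lia.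
pose g (j : nat) : int := H j%:Z - H (j%:Z - 1).
have g_lt j : (j < a)%N -> g j = j.+1%:Z.
  move=> ja; have := full j%:Z; have := full (j%:Z - 1).
  move=> /(_ ltac:(lia) ltac:(lia)) E1 /(_ ltac:(lia) ltac:(lia)) E0.
  by rewrite /g intS; lra.
have g_anti i j : (i + j + 2 = c + 3)%N -> g i = - g j.
  move=> ij; rewrite /g (h_symz i) (h_symz (i%:Z - 1)).
  have -> : c%:Z - i%:Z = j%:Z - 1 by lia.
  have -> : c%:Z - (i%:Z - 1) = j%:Z by lia.
  by rewrite opprB.
(* Otherwise a - 1 and its mirror c + 2 - a would both lie below a, where g is positive; and for a >
   c + 2 the value g (a - 1) = a would have to vanish. *)
have as2 : (2 * a < c + 3)%N.
  rewrite ltnNge; apply/negP => ca.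
  have [ac|ac] := leqP a c.+2.
    have := g_anti (c + 2 - a)%N a.-1; rewrite !g_lt; try lia.
  have := g_lt a.-1; rewrite /g h_top ?h_top; lia.
(* The mirror of a has positive third difference, so b does not exceed it. *)
have abs : (a + b <= c + 3)%N.
  have : b%:Z <= c%:Z + 3 - a%:Z; last lia.
  by apply: m2; rewrite third_diff_anti; lia.
have g_bnd j : (a <= j)%N -> (2 * j + 2 <= c + 3)%N -> 0 <= g j <= a%:Z.
  move=> aj jc; have := @h_diff a j; rewrite aj (ltnW a_gt1).
  move=> /(_ ltac:(by have := bin2z a; lia) isT ltac:(lia) ltac:(lia)).
  rewrite /g; have -> : j%:Z - 1 = j.-1%:Z by lia.
  by lia.
have g_conc j : (a <= j.+1)%N -> (j.+2 < b)%N ->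
    g j.+2 - g j.+1 <= g j.+1 - g j.
  move=> aj jb; have : third_diff h j.+2%:Z <= 0.
    by rewrite leNgt; apply/negP => p; have := m2 j.+2%:Z (conj isT p); lia.
  rewrite /third_diff /g.
  have -> : j.+2%:Z - 1 = j.+1%:Z by lia.
  have -> : j.+2%:Z - 2 = j%:Z by lia.
  have -> : j.+2%:Z - 3 = j%:Z - 1 by lia.
  have -> : j.+1%:Z - 1 = j%:Z by lia.
  lia.
have -> : N2 = c%:Z + 3 - a%:Z.
  have : c%:Z + 3 - a%:Z <= N2 by apply: M2; rewrite third_diff_anti; lia.
  have : a%:Z <= c%:Z + 3 - N2 by apply: m1; rewrite third_diff_anti; lia.
  lia.
(* The condition t <= c + 1 keeps out c + 3, the mirror of t = 0, just as t > 0 does for b. *)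
have -> : N1 = c%:Z + 3 - b%:Z.
  have : c%:Z + 3 - b%:Z <= N1 by apply: M1; rewrite third_diff_anti; lia.
  have : b%:Z <= c%:Z + 3 - N1 by apply: m2; rewrite third_diff_anti; lia.
  lia.
rewrite -sum_diff_weight.
have a1 := ltnW a_gt1.
have sE : c%:Z + 3 = (c + 3)%N%:Z by lia.
rewrite !sE; apply/andP; split.
  rewrite mulrC mulrA; have [bs|bs] := leqP (2 * b) (c + 3).
    exact: lower_small.
  exact: lower_large.
rewrite [X in _ <= X * _]mulrC; have [bs|bs] := leqP (2 * b) (c + 3).
  exact: upper_small.
exact: upper_large.
Qed.

End Numeric.

(** * The Hilbert function of a Gorenstein quotient meets the numerical hypotheses *)

Theorem theorem3p1 (k : fieldType) (I : idealr {mpoly k[3]})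
    (c n1 n2 N1 N2 : int)
    (hI : homogeneous_ideal I)
    (hG : artinian_gorenstein I)
    (h1 : hilb I 1 = 3%N)
    (hc : is_max (fun t => hilb I t <> 0%N) c)
    (hn1 : is_min (fun t => third_diff (hilb I) t < 0) n1)
    (hn2 : is_min (fun t => 0 < t /\ 0 < third_diff (hilb I) t) n2)
    (hN1 : is_max (fun t => t <= c + 1 /\ third_diff (hilb I) t < 0) N1)
    (hN2 : is_max (fun t => 0 < third_diff (hilb I) t) N2) :
  (1 / (3`!)%:R) * n1%:~R * n2%:~R * (c + 3)%:~R
      <= (artinian_mult I)%:R :> rat /\
  (artinian_mult I)%:R
      <= (1 / (3`!)%:R) * N1%:~R * N2%:~R * (c + 3)%:~R :> rat.
Proof.
have [hc0 hcmax] := hc; have [_ hsoc] := hG.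
case: c hc hc0 hcmax hN1 => [c|c] hc hc0 hcmax hN1; last by case: (hc0 erefl).
have h_top (t : int) : c%:Z < t -> hilb I t = 0%N.
  move=> ct; apply/eqP/negPn/negP => /eqP/hcmax; lia.
have htop (t : nat) (p : {mpoly k[3]}) : (c < t)%N -> p \is t.-homog -> p \in I.
  by move=> ct; move: p; apply/hilb_eq0/h_top.
have [w [hw wI]] : exists w : {mpoly k[3]}, w \is c.-homog /\ w \notin I.
  apply: NNPP => nw; apply: hc0; apply/hilb_eq0 => p hp.
  by apply/negPn/negP => pI; apply: nw; exists p.
have [mu hmu] := dual_functional htop hsoc hw wI.
have hE (t : nat) : (t <= c)%N -> hilb I t = \rank (cat mu t (c - t)).
  exact: (hilb_rank hI htop hsoc hw wI hmu).
have h_bin (t : nat) : (t <= c)%N -> (hilb I t <= 'C(t.+2, 2))%N.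
  by move=> tc; rewrite hE // -card_mon rank_leq_row.
have h_sym (t : nat) : (t <= c)%N -> hilb I t = hilb I (c - t)%N.
  by move=> tc; rewrite !hE ?leq_subr // subKn // rank_cat_sym.
(* Symmetry gives h_0 = h_c, which is nonzero, and the binomial bound is 1. *)
have h0 : hilb I 0 = 1%N.
  apply/eqP; rewrite eqn_leq (h_bin 0%N) // lt0n; apply/eqP.
  by rewrite (h_sym 0%N) // subn0.
have h_diff (a t : nat) : (hilb I a < 'C(a.+2, 2))%N -> (0 < a <= t)%N ->
    (t + t <= c.+1)%N -> (t <= c)%N ->
    (hilb I t.-1 <= hilb I t <= hilb I t.-1 + a)%N.
  move=> ha hat ttc tc; rewrite !hE //; last by lia.
  by apply: rank_cat_first_diff => //; rewrite -hE //; lia.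
have h_neg (t : int) : t < 0 -> hilb I t = 0%N by case: t.
have /andP[L U] := hilbert_bounds h_neg h_top h_sym h0 h1 h_bin h_diff hn1 hn2 hN1 hN2.
move: L U.
have -> : \sum_(0 <= t < c.+1) (hilb I t%:Z)%:Z = (artinian_mult I)%:Z.
  rewrite (mult_sum hI htop hsoc hw wI hmu) big_mkord.
  by rewrite -[RHS]natz natr_sum; apply: eq_bigr => t _; rewrite natz.
move: (artinian_mult I) => e L U.
have -> : (3`!)%:R = 6 :> rat by [].
have := L; have := U; rewrite -!(ler_int rat) !intrM => U' L'.
have -> : e%:R = (e%:Z)%:~R :> rat by rewrite -pmulrn.
split; lra.
Qed.
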